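(* Assume that $S$ is a finite product of copies of the field $k$. Let $\mathcal{B}$ be a triangular differential graded $S$-bocs and let $(M,u)$ be a twisted $\mathcal{B}$-module. Then $(M,u)$ is homotopically trivial (that is, its identity morphism is null-homotopic) if and only if the complex of right $S$-modules $(M,u^0)$ is acyclic, i.e. $H^i(M,u^0)=0$ for all $i\in\mathbb{Z}$.
   Context: Conventions: $k$ is a field acting centrally on all algebras and bimodules; $S$ is graded concentrated in degree $0$. Graded means $\mathbb{Z}$-graded; a homogeneous morphism of degree $d$ shifts degrees by $d$. Tensor products over $S$ carry the usual grading, and $(f\otimes g)(x\otimes y)=(-1)^{|g||x|}f(x)\otimes g(y)$. A differential graded $S$-bocs is $\mathcal{B}=(C,\mu,\epsilon,\delta)$ with $C$ a graded $S$-$S$-bimodule, $\mu:C\to C\otimes_SC$ and $\epsilon:C\to S$ degree $0$ bimodule maps making $C$ coassociative and counital, and $\delta:C\to C$ a degree $1$ bimodule map with $\mu\delta=(id_C\otimes\delta+\delta\otimes id_C)\mu$ and $\delta^2=0$. It is normal if there is a bimodule decomposition $C=S\oplus\overline{C}$ with $\epsilon$ the projection on $S$, $\mu(1)=1\otimes1$ and $\delta(1)=0$. Then $\overline{\mu}(x)=\mu(x)-1\otimes x-x\otimes 1$ defines $\overline{\mu}:\overline{C}\to\overline{C}\otimes_S\overline{C}$ and $\delta$ restricts to $\overline{\delta}:\overline{C}\to\overline{C}$. It is triangular if it is normal and there is a chain $0=\overline{C}_0\subseteq\overline{C}_1\subseteq\cdots$ of graded $S$-$S$-subbimodules with union $\overline{C}$,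 $\overline{\mu}(\overline{C}_i)\subseteq\overline{C}_{i-1}\otimes_S\overline{C}_{i-1}$ and $\overline{\delta}(\overline{C}_i)\subseteq\overline{C}_i$ for $i\ge1$. $\mathrm{GMod}\text{-}\mathcal{B}$: objects are graded right $S$-modules; degree $d$ morphisms $M\to N$ are degree $d$ homogeneous morphisms of right $S$-modules $f:M\otimes_SC\to N$; $g*f=g(f\otimes id_C)(id_M\otimes\mu)$; identity $\mathbb{I}_M(m\otimes c)=m\epsilon(c)$; $\hat\delta(f)=(-1)^{|f|+1}f(id_M\otimes\delta)$. The first component of $f$ is $f^0:M\to N$, $f^0(m)=f(m\otimes1)$. A twisted $\mathcal{B}$-module is a pair $(M,u)$ with $u:M\to M$ a degree $1$ morphism of $\mathrm{GMod}\text{-}\mathcal{B}$ and $\hat\delta(u)+u*u=0$; then $(u^0)^2=0$, so $(M,u^0)$ is a complex of right $S$-modules. $(M,u)$ is homotopically trivial iff there is a degree $-1$ morphism $h:M\to M$ of $\mathrm{GMod}\text{-}\mathcal{B}$ with $\mathbb{I}_M=\hat\delta(h)+u*h+h*u$. *)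

(* Defs.v *)
From HB Require Import structures.
From mathcomp Require Import all_boot all_order all_algebra.
From mathcomp Require Import mathcomp_extra boolp classical_sets functions.
From mathcomp Require Import cardinality fsbigop.
Set Implicit Arguments.
Unset Strict Implicit.
Unset Printing Implicit Defensive.
Import Order.TTheory GRing.Theory Num.Theory.
Local Open Scope ring_scope.
Local Open Scope quotient_scope.
Local Open Scope classical_set_scope.

Reserved Notation "x *> s" (at level 40, left associativity).
Reserved Notation "x ⊗ y" (at level 40, left associativity).

(* (-1)^i x *)
Definition zsign (V : zmodType) (i : int) (x : V) : V :=
  if odd `|i|%N then - x else x.

(* Gradings are internal: a module M together with the projections
   hcomp i : M -> M onto its components M_i. *)
HB.mixin Record isRModule (S : pzRingType) M of GRing.Zmodule M := {
  ract : M -> S -> M;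
  ractDl : forall x y s, ract (x + y) s = ract x s + ract y s;
  ractDr : forall x s t, ract x (s + t) = ract x s + ract x t;
  ractA : forall x s t, ract (ract x s) t = ract x (s * t);
  ract1 : forall x, ract x 1 = x
}.

#[short(type="rModType")]
HB.structure Definition RModule (S : pzRingType) :=
  {M of GRing.Zmodule M & isRModule S M}.

Notation "x *> s" := (ract x s) : ring_scope.

HB.mixin Record isGradedRModule (S : pzRingType) M of RModule S M := {
  hcomp : int -> M -> M;
  hcompD : forall i x y, hcomp i (x + y) = hcomp i x + hcomp i y;
  hcomp_ract : forall i x (s : S), hcomp i (x *> s) = hcomp i x *> s;
  hcompK : forall i j x, hcomp i (hcomp j x) = if i == j then hcomp j x else 0;
  hcomp_fin : forall x, finite_set [set i | hcomp i x != 0];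
  hcomp_sum : forall x, \sum_(i \in [set: int]) hcomp i x = x
}.

#[short(type="grRModType")]
HB.structure Definition GrRModule (S : pzRingType) :=
  {M of isGradedRModule S M & RModule S M}.

HB.mixin Record isGradedBimodule (S : pzRingType) M
    of GRing.Lmodule S M & GrRModule S M := {
  scale_ract : forall (s t : S) (x : M), (s *: x) *> t = s *: (x *> t);
  hcompZ : forall i (s : S) (x : M), hcomp i (s *: x) = s *: hcomp i x
}.

#[short(type="grBimodType")]
HB.structure Definition GrBimodule (S : pzRingType) :=
  {M of GRing.Lmodule S M & GrRModule S M & isGradedBimodule S M}.

Definition homog (S : pzRingType) (M : grRModType S) (i : int) : set M :=
  [set x | hcomp i x = x].

Section Theory.
Variables (S : pzRingType).

Lemma zsign0 (V : zmodType) i : zsign i (0 : V) = 0.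
Proof. by rewrite /zsign; case: ifP; rewrite ?oppr0. Qed.

Lemma zsignD (V : zmodType) i (x y : V) : zsign i (x + y) = zsign i x + zsign i y.
Proof. by rewrite /zsign; case: ifP; rewrite ?opprD. Qed.

Lemma fsbig_seqT (V : zmodType) (F : int -> V) (s : seq int) :
  uniq s -> (forall i, i \notin s -> F i = 0) ->
  \sum_(i \in [set: int]) F i = \sum_(i <- s) F i.
Proof.
move=> us Fs; rewrite (fsbigE s) //.
  by apply: eq_bigl => i; rewrite in_setT.
by move=> i _; apply: Fs.
Qed.

Lemma fsbigD_fin (V : zmodType) (F G : int -> V) (A : set int) :
  finite_set A -> (forall i, ~ A i -> F i = 0) -> (forall i, ~ A i -> G i = 0) ->
  \sum_(i \in [set: int]) (F i + G i) =
    \sum_(i \in [set: int]) F i + \sum_(i \in [set: int]) G i.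
Proof.
move=> /finite_seqP[s0 sE] FA GA.
have sP i : i \notin undup s0 -> ~ A i.
  by rewrite mem_undup sE => /negP h /h.
have us := undup_uniq s0.
rewrite !(fsbig_seqT us) ?big_split //= => i /sP h; rewrite ?FA ?GA ?addr0 //.
Qed.

Section RMod.
Variable M : grRModType S.
Implicit Types x y : M.

Lemma ract0l s : (0 : M) *> s = 0.
Proof. by apply: (addIr (0 *> s)); rewrite -ractDl !add0r. Qed.
Lemma ractNl x s : (- x) *> s = - (x *> s).
Proof. by apply: (addIr (x *> s)); rewrite -ractDl !addNr ract0l. Qed.

Lemma hcomp0 i : hcomp i (0 : M) = 0.
Proof. by apply: (addIr (hcomp i 0)); rewrite -hcompD !add0r. Qed.
Lemma hcompN i x : hcomp i (- x) = - hcomp i x.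
Proof. by apply: (addIr (hcomp i x)); rewrite -hcompD !addNr hcomp0. Qed.

Lemma hcomp_homog i x : homog i (hcomp i x).
Proof. by rewrite /homog /= hcompK eqxx. Qed.

Lemma hcomp_homogE i j x : homog j x -> hcomp i x = if i == j then x else 0.
Proof. by move=> <-; rewrite hcompK. Qed.

Lemma homog_dec x : exists s : seq int,
  uniq s /\ (forall i, i \notin s -> hcomp i x = 0) /\ x = \sum_(i <- s) hcomp i x.
Proof.
have [s0 sE] : exists s0 : seq int, [set i | hcomp i x != 0] = [set` s0].
  by apply/finite_seqP; apply: hcomp_fin.
have h i : i \notin undup s0 -> hcomp i x = 0.
  rewrite mem_undup; apply: contraNeq => hx.
  by have : [set` s0] i by rewrite -sE.
exists (undup s0); split; [exact: undup_uniq|split=> //].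
by rewrite -{1}(hcomp_sum x) (fsbig_seqT (undup_uniq s0) h).
Qed.

(* the map x |-> (-1)^(e |x|) x *)
Definition koszul (e : int) (x : M) : M :=
  \sum_(i \in [set: int]) zsign (e * i) (hcomp i x).

Lemma koszulD e : {morph koszul e : x y / x + y}.
Proof.
move=> x y; rewrite /koszul.
rewrite -(fsbigD_fin (A := [set i | hcomp i x != 0] `|` [set i | hcomp i y != 0])).
- by apply: eq_fsbigr => i _; rewrite hcompD zsignD.
- by rewrite finite_setU; split; apply: hcomp_fin.
- move=> i h; have [->|hx] := eqVneq (hcomp i x) 0; first exact: zsign0.
  by case: h; left.
- move=> i h; have [->|hx] := eqVneq (hcomp i y) 0; first exact: zsign0.
  by case: h; right.
Qed.

Lemma koszul_homog e i x : homog i x -> koszul e x = zsign (e * i) x.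
Proof.
move=> hx; rewrite /koszul (fsbig_seqT (s := [:: i])) //.
  by rewrite big_seq1 hx.
by move=> j; rewrite inE => /negPf ji; rewrite (hcomp_homogE _ hx) ji zsign0.
Qed.

Lemma koszul_ract e x s : koszul e (x *> s) = koszul e x *> s.
Proof.
have [r [ur [hr _]]] := homog_dec x.
rewrite /koszul !(fsbig_seqT ur) => [|i /hr ->|i /hr h]; last 2 first.
- exact: zsign0.
- by rewrite hcomp_ract h ract0l zsign0.
rewrite (big_morph (fun x => x *> s) (fun x y => ractDl x y s) (ract0l s)).
by apply: eq_bigr => i _; rewrite hcomp_ract /zsign; case: ifP; rewrite ?ractNl.
Qed.

End RMod.
End Theory.

(* The tensor product M ⊗_S C: the abelian group generated by the symbols
   (x, y), subject to biadditivity and S-balancedness. A sequence of pairs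
   stands for the sum of its members; opposites come from (- x, y). *)
Section Tensor.
Variables (S : pzRingType) (M : grRModType S) (C : grBimodType S).

Inductive tens_rel : seq (M * C) -> seq (M * C) -> Prop :=
| tens_refl r : tens_rel r r
| tens_sym r1 r2 : tens_rel r1 r2 -> tens_rel r2 r1
| tens_trans r1 r2 r3 : tens_rel r1 r2 -> tens_rel r2 r3 -> tens_rel r1 r3
| tens_cat r1 r2 r1' r2' :
    tens_rel r1 r2 -> tens_rel r1' r2' -> tens_rel (r1 ++ r1') (r2 ++ r2')
| tens_comm r1 r2 : tens_rel (r1 ++ r2) (r2 ++ r1)
| tens_0 y : tens_rel [:: (0, y)] [::]
| tens_Dl x x' y : tens_rel [:: (x + x', y)] [:: (x, y); (x', y)]
| tens_Dr x y y' : tens_rel [:: (x, y + y')] [:: (x, y); (x, y')]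
| tens_bal x s y : tens_rel [:: (x *> s, y)] [:: (x, s *: y)].

Definition tens_relb (r1 r2 : seq (M * C)) : bool := `[< tens_rel r1 r2 >].

Lemma tens_relb_equiv : equiv_class_of tens_relb.
Proof.
split.
- by move=> r; apply/asboolP; apply: tens_refl.
- by move=> r1 r2; apply/asboolP/asboolP; apply: tens_sym.
- move=> r2 r1 r3 /asboolP h1 /asboolP h2; apply/asboolP.
  exact: tens_trans h1 h2.
Qed.

Canonical tens_equiv := EquivRelPack tens_relb_equiv.
Definition tens := {eq_quot tens_equiv}.
HB.instance Definition _ : EqQuotient _ tens_equiv tens := EqQuotient.on tens.
HB.instance Definition _ := Choice.on tens.

Lemma tens_eqP r1 r2 : \pi_tens r1 = \pi_tens r2 <-> tens_rel r1 r2.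
Proof.
split=> [/eqP|h]; first by rewrite piE => /asboolP.
by apply/eqP; rewrite piE; apply/asboolP.
Qed.

Definition tens_opp_seq (r : seq (M * C)) := [seq (- p.1, p.2) | p <- r].
Definition tens_add (t1 t2 : tens) : tens := \pi_tens (repr t1 ++ repr t2).
Definition tens_opp (t : tens) : tens := \pi_tens (tens_opp_seq (repr t)).

Lemma tens_addE r1 r2 :
  tens_add (\pi_tens r1) (\pi_tens r2) = \pi_tens (r1 ++ r2).
Proof.
by apply/tens_eqP; apply: tens_cat; apply/tens_eqP; rewrite reprK.
Qed.

Lemma tens_addA : associative tens_add.
Proof.
move=> a b c; rewrite -(reprK a) -(reprK b) -(reprK c).
move: (repr a) (repr b) (repr c) => ra rb rc.
by rewrite (tens_addE rb rc) (tens_addE ra rb) (tens_addE ra) (tens_addE _ rc) catA.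
Qed.
Lemma tens_addC : commutative tens_add.
Proof. by move=> a b; apply/tens_eqP; apply: tens_comm. Qed.
Lemma tens_add0 : left_id (\pi_tens [::]) tens_add.
Proof. by move=> a; rewrite -(reprK a) tens_addE. Qed.
Lemma tens_rel_opp r : tens_rel (tens_opp_seq r ++ r) [::].
Proof.
elim: r => [|[x y] r IH]; first exact: tens_refl.
rewrite /= -[_ :: _]cat1s -[(x, y) :: r]cat1s.
have h1 : tens_rel ([:: (- x, y)] ++ [:: (x, y)]) [::].
  apply: (tens_trans (r2 := [:: (- x + x, y)])); last first.
    by rewrite addNr; apply: tens_0.
  by apply/tens_sym/tens_Dl.
apply: (tens_trans (r2 := ([:: (- x, y)] ++ [:: (x, y)]) ++
                          (tens_opp_seq r ++ r))).
  rewrite -!catA; apply: tens_cat; first exact: tens_refl.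
  rewrite !catA; apply: tens_cat; last exact: tens_refl.
  exact: tens_comm.
exact: (tens_cat (r2 := [::]) (r2' := [::])).
Qed.
Lemma tens_addN : left_inverse (\pi_tens [::]) tens_opp tens_add.
Proof.
move=> a; rewrite -{2}(reprK a) tens_addE; apply/tens_eqP.
exact: tens_rel_opp.
Qed.

HB.instance Definition _ :=
  GRing.isZmodule.Build tens tens_addA tens_addC tens_add0 tens_addN.

Definition tpure (x : M) (y : C) : tens := \pi_tens [:: (x, y)].

Notation "x ⊗ y" := (tpure x y) : ring_scope.

Lemma tpureDl x x' y : (x + x') ⊗ y = x ⊗ y + x' ⊗ y.
Proof. by rewrite [RHS]tens_addE; apply/tens_eqP; apply: tens_Dl. Qed.
Lemma tpureDr x y y' : x ⊗ (y + y') = x ⊗ y + x ⊗ y'.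
Proof. by rewrite [RHS]tens_addE; apply/tens_eqP; apply: tens_Dr. Qed.
Lemma tpure_bal x s y : (x *> s) ⊗ y = x ⊗ (s *: y).
Proof. by apply/tens_eqP; apply: tens_bal. Qed.
Lemma tpure0l y : 0 ⊗ y = 0.
Proof. by apply: (addIr (0 ⊗ y)); rewrite -tpureDl !add0r. Qed.
Lemma tpure0r x : x ⊗ 0 = 0.
Proof. by apply: (addIr (x ⊗ 0)); rewrite -tpureDr !add0r. Qed.
Lemma tpureNl x y : (- x) ⊗ y = - (x ⊗ y).
Proof. by apply: (addIr (x ⊗ y)); rewrite -tpureDl !addNr tpure0l. Qed.

Lemma pi_tensE r : \pi_tens r = \sum_(p <- r) p.1 ⊗ p.2.
Proof.
elim: r => [|[x y] r IH]; first by rewrite big_nil.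
by rewrite big_cons /= -IH [RHS]tens_addE.
Qed.

Lemma tens_sumE (t : tens) : t = \sum_(p <- repr t) p.1 ⊗ p.2.
Proof. by rewrite -pi_tensE reprK. Qed.

Lemma tens_ind0 (P : tens -> Prop) : P 0 -> (forall t t', P t -> P t' -> P (t + t')) ->
  (forall x y, P (x ⊗ y)) -> forall t, P t.
Proof. by move=> P0 PD Pp t; rewrite (tens_sumE t); apply: (big_ind P). Qed.

(* The additive map sending x ⊗ y to b x y. It is defined for every b, but is
   meaningful only for balanced b, see tliftE. *)
Definition tlift (A : zmodType) (b : M -> C -> A) (t : tens) : A :=
  \sum_(p <- repr t) b p.1 p.2.

Record balanced (A : zmodType) (b : M -> C -> A) : Prop := Balanced {
  balDl : forall x x' y, b (x + x') y = b x y + b x' y;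
  balDr : forall x y y', b x (y + y') = b x y + b x y';
  balS : forall x s y, b (x *> s) y = b x (s *: y)
}.

Section Lift.
Variables (A : zmodType) (b : M -> C -> A).
Hypothesis bb : balanced b.

Lemma bal0l y : b 0 y = 0.
Proof. by apply: (addIr (b 0 y)); rewrite -(balDl bb) !add0r. Qed.
Lemma bal0r x : b x 0 = 0.
Proof. by apply: (addIr (b x 0)); rewrite -(balDr bb) !add0r. Qed.

Lemma tlift_pi r : tlift b (\pi_tens r) = \sum_(p <- r) b p.1 p.2.
Proof.
have: tens_rel (repr (\pi_tens r)) r by apply/tens_eqP; rewrite reprK.
rewrite /tlift; move: (repr _) => r0; elim=> {r r0} //.
- by move=> r1 r2 r3 _ -> _ ->.
- by move=> r1 r2 r1' r2' _ h1 _ h2; rewrite !big_cat h1 h2.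
- by move=> r1 r2; rewrite !big_cat /= addrC.
- by move=> y; rewrite big_seq1 big_nil bal0l.
- by move=> x x' y; rewrite !big_cons !big_nil !addr0 /= (balDl bb).
- by move=> x y y'; rewrite !big_cons !big_nil !addr0 /= (balDr bb).
- by move=> x s y; rewrite !big_seq1 (balS bb).
Qed.

Lemma tliftE x y : tlift b (x ⊗ y) = b x y.
Proof. by rewrite tlift_pi big_seq1. Qed.

Lemma tliftD : {morph tlift b : t t' / t + t'}.
Proof.
by move=> t t'; rewrite [t + t']/(tens_add t t') tlift_pi big_cat.
Qed.

Lemma tlift0 : tlift b 0 = 0.
Proof. by rewrite -[LHS]/(tlift b (\pi_tens [::])) tlift_pi big_nil. Qed.

End Lift.

Definition tens_ract (t : tens) (s : S) : tens :=
  tlift (fun x y => x ⊗ (y *> s)) t.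
Definition tens_hcomp (n : int) (t : tens) : tens :=
  tlift (fun x y => \sum_(i \in [set: int]) hcomp i x ⊗ hcomp (n - i) y) t.

Lemma tens_ract_bal s : balanced (fun x y => x ⊗ (y *> s)).
Proof.
split=> [x x' y|x y y'|x t y]; rewrite ?tpureDl ?ractDl ?tpureDr //.
by rewrite tpure_bal scale_ract.
Qed.

Lemma tens_ractE x y s : tens_ract (x ⊗ y) s = x ⊗ (y *> s).
Proof. exact: tliftE (tens_ract_bal s) x y. Qed.
Lemma tens_ractDl x y s : tens_ract (x + y) s = tens_ract x s + tens_ract y s.
Proof. exact: tliftD (tens_ract_bal s) x y. Qed.
Lemma tens_ract0 s : tens_ract 0 s = 0.
Proof. exact: tlift0 (tens_ract_bal s). Qed.

Lemma tens_ractDr x s t : tens_ract x (s + t) = tens_ract x s + tens_ract x t.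
Proof.
elim/tens_ind0: x => [|x y hx hy|x y]; first by rewrite !tens_ract0 addr0.
  by rewrite !tens_ractDl hx hy addrACA.
by rewrite !tens_ractE ractDr tpureDr.
Qed.
Lemma tens_ractA x s t : tens_ract (tens_ract x s) t = tens_ract x (s * t).
Proof.
elim/tens_ind0: x => [|x y hx hy|x y]; first by rewrite !tens_ract0.
  by rewrite !tens_ractDl hx hy.
by rewrite !tens_ractE ractA.
Qed.
Lemma tens_ract1 x : tens_ract x 1 = x.
Proof.
elim/tens_ind0: x => [|x y hx hy|x y]; first by rewrite !tens_ract0.
  by rewrite !tens_ractDl hx hy.
by rewrite !tens_ractE ract1.
Qed.

HB.instance Definition _ :=
  isRModule.Build S tens tens_ractDl tens_ractDr tens_ractA tens_ract1.

Lemma tens_hcomp_bal n :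
  balanced (fun x y => \sum_(i \in [set: int]) hcomp i x ⊗ hcomp (n - i) y).
Proof.
split=> [x x' y|x y y'|x s y].
- rewrite -(fsbigD_fin (A := [set i | hcomp i x != 0] `|` [set i | hcomp i x' != 0])).
  + by apply: eq_fsbigr => i _; rewrite hcompD tpureDl.
  + by rewrite finite_setU; split; apply: hcomp_fin.
  + move=> i h; have [->|hx] := eqVneq (hcomp i x) 0; first exact: tpure0l.
    by case: h; left.
  + move=> i h; have [->|hx] := eqVneq (hcomp i x') 0; first exact: tpure0l.
    by case: h; right.
- rewrite -(fsbigD_fin (A := [set i | hcomp i x != 0])).
  + by apply: eq_fsbigr => i _; rewrite hcompD tpureDr.
  + exact: hcomp_fin.
  + move=> i h; have [->|hx] := eqVneq (hcomp i x) 0; first exact: tpure0l.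
    by case: h.
  + move=> i h; have [->|hx] := eqVneq (hcomp i x) 0; first exact: tpure0l.
    by case: h.
- by apply: eq_fsbigr => i _; rewrite hcomp_ract hcompZ tpure_bal.
Qed.

Lemma tens_hcompD n x y : tens_hcomp n (x + y) = tens_hcomp n x + tens_hcomp n y.
Proof. exact: tliftD (tens_hcomp_bal n) x y. Qed.
Lemma tens_hcomp0 n : tens_hcomp n 0 = 0.
Proof. exact: tlift0 (tens_hcomp_bal n). Qed.

Lemma tens_hcompE n a b x y : homog a x -> homog b y ->
  tens_hcomp n (x ⊗ y) = if n == a + b then x ⊗ y else 0.
Proof.
move=> hx hy; rewrite /tens_hcomp (tliftE (tens_hcomp_bal n)).
rewrite (fsbig_seqT (s := [:: a])) //.
  rewrite big_seq1 hx (hcomp_homogE _ hy) subr_eq [b + a]addrC.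
  by case: ifP => // _; rewrite tpure0r.
by move=> j; rewrite inE => /negPf ja; rewrite (hcomp_homogE _ hx) ja tpure0l.
Qed.

Lemma tens_hind (P : tens -> Prop) :
  P 0 -> (forall t t', P t -> P t' -> P (t + t')) ->
  (forall a b x y, homog a x -> homog b y -> P (x ⊗ y)) -> forall t, P t.
Proof.
move=> P0 PD Pp; apply: tens_ind0 => // x y.
have [r [_ [_ ->]]] := homog_dec x; have [r' [_ [_ ->]]] := homog_dec y.
rewrite (big_morph (tpure^~ _) (fun x x' => tpureDl x x' _) (tpure0l _)).
apply: big_ind => // i _.
rewrite (big_morph (tpure _) (tpureDr _) (tpure0r _)).
by apply: big_ind => // j _; apply: Pp; apply: hcomp_homog.
Qed.

Lemma tens_hcomp_ract n t (s : S) : tens_hcomp n (t *> s) = tens_hcomp n t *> s.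
Proof.
rewrite /ract /=.
elim/tens_hind: t => [|x y hx hy|a b x y hx hy].
- by rewrite tens_ract0 tens_hcomp0 tens_ract0.
- by rewrite tens_ractDl !tens_hcompD tens_ractDl hx hy.
rewrite tens_ractE !(tens_hcompE _ hx (b := b)) //.
  by case: ifP; rewrite ?tens_ractE ?tens_ract0.
by rewrite /homog /= hcomp_ract hy.
Qed.

Lemma tens_hcompK i j t :
  tens_hcomp i (tens_hcomp j t) = if i == j then tens_hcomp j t else 0.
Proof.
elim/tens_hind: t => [|x y hx hy|a b x y hx hy].
- by rewrite !tens_hcomp0; case: ifP.
- by rewrite !tens_hcompD hx hy; case: ifP => // _; rewrite addr0.
rewrite (tens_hcompE j hx hy); case: (eqVneq j (a + b)) => [->|_].
  by rewrite (tens_hcompE i hx hy).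
by rewrite tens_hcomp0; case: ifP.
Qed.

Lemma tens_hcomp_fin t : finite_set [set i | tens_hcomp i t != 0].
Proof.
elim/tens_hind: t => [|x y hx hy|a b x y hx hy].
- apply: sub_finite_set (finite_set0 int) => i /=.
  by rewrite tens_hcomp0 eqxx.
- have h : finite_set ([set i | tens_hcomp i x != 0] `|`
                       [set i | tens_hcomp i y != 0]).
    by rewrite finite_setU.
  apply: sub_finite_set h => i /=; rewrite tens_hcompD.
  have [->|h _] := eqVneq (tens_hcomp i x) 0; last by left.
  by rewrite add0r; right.
- apply: sub_finite_set (finite_set1 (a + b)) => i /=.
  by rewrite (tens_hcompE i hx hy); case: (eqVneq i (a + b)) => // _; rewrite eqxx.
Qed.

Lemma tens_hcomp_sum t : \sum_(i \in [set: int]) tens_hcomp i t = t.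
Proof.
elim/tens_hind: t => [|x y hx hy|a b x y hx hy].
- by rewrite (fsbig_seqT (s := [::])) ?big_nil // => i _; rewrite tens_hcomp0.
- apply: etrans (congr2 +%R hx hy); rewrite -(fsbigD_fin (A := [set i | tens_hcomp i x != 0] `|`
                       [set i | tens_hcomp i y != 0])).
  + by apply: eq_fsbigr => i _; rewrite tens_hcompD.
  + by rewrite finite_setU; split; apply: tens_hcomp_fin.
  + by move=> i h; apply: contrapT => /eqP k; apply: h; left.
  + by move=> i h; apply: contrapT => /eqP k; apply: h; right.
- rewrite (fsbig_seqT (s := [:: a + b])) //.
    by rewrite big_seq1 (tens_hcompE _ hx hy) eqxx.
  by move=> i; rewrite inE => /negPf h; rewrite (tens_hcompE _ hx hy) h.
Qed.

HB.instance Definition _ := isGradedRModule.Build S tens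
  tens_hcompD tens_hcomp_ract tens_hcompK tens_hcomp_fin tens_hcomp_sum.

End Tensor.

Notation "x ⊗ y" := (tpure x y) : ring_scope.

Section BimoduleTensor.
Variables (S : pzRingType) (M C : grBimodType S).

Definition tens_scale (s : S) (t : tens M C) : tens M C :=
  tlift (fun x y => (s *: x) ⊗ y) t.

Lemma tens_scale_bal s : balanced (fun (x : M) (y : C) => (s *: x) ⊗ y).
Proof.
split=> [x x' y|x y y'|x t y]; rewrite ?scalerDr ?tpureDl ?tpureDr //.
by rewrite -scale_ract tpure_bal.
Qed.

Lemma tens_scaleE s x y : tens_scale s (x ⊗ y) = (s *: x) ⊗ y.
Proof. exact: tliftE (tens_scale_bal s) x y. Qed.
Lemma tens_scaleDr s : {morph tens_scale s : x y / x + y}.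
Proof. exact: tliftD (tens_scale_bal s). Qed.
Lemma tens_scale0 s : tens_scale s 0 = 0.
Proof. exact: tlift0 (tens_scale_bal s). Qed.

Lemma tens_scaleA s t x : tens_scale s (tens_scale t x) = tens_scale (s * t) x.
Proof.
elim/tens_ind0: x => [|x y hx hy|x y]; first by rewrite !tens_scale0.
  by rewrite !tens_scaleDr hx hy.
by rewrite !tens_scaleE scalerA.
Qed.
Lemma tens_scale1 : left_id 1 tens_scale.
Proof.
move=> x; elim/tens_ind0: x => [|x y hx hy|x y]; first by rewrite !tens_scale0.
  by rewrite !tens_scaleDr hx hy.
by rewrite !tens_scaleE scale1r.
Qed.
Lemma tens_scaleDl t : {morph tens_scale^~ t : r s / r + s}.
Proof.
move=> r s; elim/tens_ind0: t => [|x y hx hy|x y].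
- by rewrite !tens_scale0 addr0.
- by rewrite !tens_scaleDr hx hy addrACA.
- by rewrite !tens_scaleE scalerDl tpureDl.
Qed.

HB.instance Definition _ := GRing.Zmodule_isLmodule.Build S (tens M C)
  tens_scaleA tens_scale1 tens_scaleDr tens_scaleDl.

Lemma tens_scale_ract (s t : S) (x : tens M C) : (s *: x) *> t = s *: (x *> t).
Proof.
change (tens_ract (tens_scale s x) t = tens_scale s (tens_ract x t)).
elim/tens_ind0: x => [|x y hx hy|x y].
- by rewrite !(tens_scale0, tens_ract0).
- by rewrite !(tens_scaleDr, tens_ractDl) hx hy.
- by rewrite !(tens_scaleE, tens_ractE).
Qed.

Lemma tens_hcompZ i (s : S) (x : tens M C) : hcomp i (s *: x) = s *: hcomp i x.
Proof.
change (tens_hcomp i (tens_scale s x) = tens_scale s (tens_hcomp i x)).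
elim/tens_hind: x => [|x y hx hy|a b x y hx hy].
- by rewrite !(tens_scale0, tens_hcomp0).
- by rewrite !(tens_scaleDr, tens_hcompD) hx hy.
rewrite tens_scaleE !(tens_hcompE _ (a := a) _ hy) //.
  by case: ifP; rewrite ?tens_scaleE ?tens_scale0.
by rewrite /homog /= hcompZ hx.
Qed.

HB.instance Definition _ := isGradedBimodule.Build S (tens M C)
  tens_scale_ract tens_hcompZ.

End BimoduleTensor.

(* S as a graded S-S-bimodule concentrated in degree 0 *)
Section Regular.
Variable S : pzRingType.

Definition reg_ract (x : S^o) (s : S) : S^o := (x : S) * s.
Definition reg_hcomp (i : int) (x : S^o) : S^o := if i == 0 then x else 0.

Lemma reg_ractDl x y s : reg_ract (x + y) s = reg_ract x s + reg_ract y s.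
Proof. exact: mulrDl. Qed.
Lemma reg_ractDr x s t : reg_ract x (s + t) = reg_ract x s + reg_ract x t.
Proof. exact: mulrDr. Qed.
Lemma reg_ractA x s t : reg_ract (reg_ract x s) t = reg_ract x (s * t).
Proof. by rewrite /reg_ract mulrA. Qed.
Lemma reg_ract1 x : reg_ract x 1 = x.
Proof. exact: mulr1. Qed.

HB.instance Definition _ :=
  isRModule.Build S S^o reg_ractDl reg_ractDr reg_ractA reg_ract1.

Lemma reg_hcompD i x y : reg_hcomp i (x + y) = reg_hcomp i x + reg_hcomp i y.
Proof. by rewrite /reg_hcomp; case: ifP => // _; rewrite addr0. Qed.
Lemma reg_hcomp_ract i (x : S^o) (s : S) :
  reg_hcomp i (x *> s) = reg_hcomp i x *> s.
Proof. by rewrite /reg_hcomp; case: ifP => // _; rewrite [RHS]mul0r. Qed.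
Lemma reg_hcompK i j x :
  reg_hcomp i (reg_hcomp j x) = if i == j then reg_hcomp j x else 0.
Proof.
rewrite /reg_hcomp; case: (eqVneq j 0) => [->|_]; case: (eqVneq i 0) => //.
  by case: ifP.
by case: ifP.
Qed.
Lemma reg_hcomp_fin x : finite_set [set i | reg_hcomp i x != 0].
Proof.
apply: sub_finite_set (finite_set1 0) => i /=.
by rewrite /reg_hcomp; case: (eqVneq i 0) => // _; rewrite eqxx.
Qed.
Lemma reg_hcomp_sum x : \sum_(i \in [set: int]) reg_hcomp i x = x.
Proof.
rewrite (fsbig_seqT (s := [:: 0])) //; first by rewrite big_seq1 /reg_hcomp eqxx.
by move=> i; rewrite inE /reg_hcomp => /negPf ->.
Qed.

HB.instance Definition _ := isGradedRModule.Build S S^o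
  reg_hcompD reg_hcomp_ract reg_hcompK reg_hcomp_fin reg_hcomp_sum.

Lemma reg_scale_ract (s t : S) (x : S^o) : (s *: x) *> t = s *: (x *> t).
Proof. exact: (esym (mulrA s (x : S) t)). Qed.
Lemma reg_hcompZ i (s : S) (x : S^o) : hcomp i (s *: x) = s *: hcomp i x.
Proof.
by rewrite /hcomp /= /reg_hcomp; case: ifP => // _; rewrite [RHS]mulr0.
Qed.

HB.instance Definition _ := isGradedBimodule.Build S S^o
  reg_scale_ract reg_hcompZ.

End Regular.

Record is_grhom (S : pzRingType) (M N : grRModType S) (d : int) (f : M -> N) : Prop :=
  IsGrHom {
    grhomD : {morph f : x y / x + y};
    grhomR : forall x (s : S), f (x *> s) = f x *> s;
    grhom_deg : forall i x, homog i x -> homog (i + d) (f x)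
  }.

Record is_grbihom (S : pzRingType) (M N : grBimodType S) (d : int) (f : M -> N) : Prop :=
  IsGrBihom {
    grbihom_hom : is_grhom d f;
    grbihomL : forall (s : S) x, f (s *: x) = s *: f x
  }.

(* The map f ⊗ g with |g| = e, acting on homogeneous elements by
   x ⊗ y |-> (-1)^(e |x|) f x ⊗ g y, see tmapE. *)
Definition tmap (S : pzRingType) (M N : grRModType S) (C D : grBimodType S)
    (e : int) (f : M -> N) (g : C -> D) (t : tens M C) : tens N D :=
  tlift (fun x y => f (koszul e x) ⊗ g y) t.

(* The associativity isomorphism x ⊗ (y ⊗ z) |-> (x ⊗ y) ⊗ z *)
Definition tassoc (S : pzRingType) (M : grRModType S) (C D : grBimodType S)
    (t : tens M (tens C D)) : tens (tens M C) D :=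
  tlift (fun x (w : tens C D) => tlift (fun y z => (x ⊗ y) ⊗ z) w) t.

(* The unit isomorphisms S ⊗ C -> C and M ⊗ S -> M *)
Definition tlunit (S : pzRingType) (C : grBimodType S) (t : tens S^o C) : C :=
  tlift (fun (s : S^o) (y : C) => (s : S) *: y) t.
Definition trunit (S : pzRingType) (M : grRModType S) (t : tens M S^o) : M :=
  tlift (fun (x : M) (s : S^o) => x *> (s : S)) t.

Section TensorMapsTheory.
Variable S : pzRingType.

Lemma tmap_bal (M N : grRModType S) (C D : grBimodType S) d (e e' : int)
    (f : M -> N) (g : C -> D) : is_grhom d f -> is_grbihom e' g ->
  balanced (fun x y => f (koszul e x) ⊗ g y).
Proof.
move=> hf hg; split=> [x x' y|x y y'|x s y].
- by rewrite koszulD (grhomD hf) tpureDl.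
- by rewrite (grhomD (grbihom_hom hg)) tpureDr.
- by rewrite koszul_ract (grhomR hf) tpure_bal (grbihomL hg).
Qed.

Lemma tmapE (M N : grRModType S) (C D : grBimodType S) d (e e' : int)
    (f : M -> N) (g : C -> D) i x y : is_grhom d f -> is_grbihom e' g ->
  homog i x -> tmap e f g (x ⊗ y) = zsign (e * i) (f x ⊗ g y).
Proof.
move=> hf hg hx; rewrite /tmap (tliftE (tmap_bal e hf hg)) (koszul_homog e hx).
rewrite /zsign; case: ifP => // _.
have f0 : f 0 = 0 by apply: (addIr (f 0)); rewrite -(grhomD hf) !add0r.
have -> : f (- x) = - f x.
  by apply: (addIr (f x)); rewrite -(grhomD hf) !addNr.
exact: tpureNl.
Qed.

Lemma tassoc_bal1 (M : grRModType S) (C D : grBimodType S) (x : M) :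
  balanced (fun (y : C) (z : D) => (x ⊗ y) ⊗ z).
Proof.
split=> [y y' z|y z z'|y s z]; rewrite ?(tpureDl, tpureDr) //.
by rewrite -tpure_bal -[(x ⊗ y) *> s]/(tens_ract (x ⊗ y) s) tens_ractE.
Qed.

Lemma tassoc_bal2 (M : grRModType S) (C D : grBimodType S) :
  balanced (fun (x : M) (w : tens C D) => tlift (fun y z => (x ⊗ y) ⊗ z) w).
Proof.
have b := @tassoc_bal1 M C D.
split=> [x x' w|x w w'|x s w].
- elim/tens_ind0: w => [|w w' h h'|y z].
  + by rewrite !(tlift0 (b _)) addr0.
  + by rewrite !(tliftD (b _)) h h' addrACA.
  + by rewrite !(tliftE (b _)) !tpureDl.
- exact: tliftD (b _) _ _.
- change (tlift (fun y z => x *> s ⊗ y ⊗ z) w =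
          tlift (fun y z => x ⊗ y ⊗ z) (tens_scale s w)).
  elim/tens_ind0: w => [|w w' h h'|y z].
  + by rewrite tens_scale0 !(tlift0 (b _)).
  + by rewrite tens_scaleDr !(tliftD (b _)) h h'.
  + by rewrite tens_scaleE !(tliftE (b _)) tpure_bal.
Qed.

Lemma tassocE (M : grRModType S) (C D : grBimodType S) (x : M) (y : C) (z : D) :
  tassoc (x ⊗ (y ⊗ z)) = (x ⊗ y) ⊗ z.
Proof.
by rewrite /tassoc (tliftE (@tassoc_bal2 M C D)) (tliftE (@tassoc_bal1 M C D x)).
Qed.

Lemma tlunitE (C : grBimodType S) (s : S^o) (y : C) :
  tlunit (s ⊗ y) = (s : S) *: y.
Proof.
rewrite /tlunit tliftE //; split=> [a b c|a b c|a b c].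
- exact: scalerDl.
- exact: scalerDr.
- by rewrite scalerA.
Qed.

Lemma trunitE (M : grRModType S) (x : M) (s : S^o) :
  trunit (x ⊗ s) = x *> (s : S).
Proof.
rewrite /trunit tliftE //; split=> [a b c|a b c|a b c].
- exact: ractDl.
- exact: ractDr.
- by rewrite ractA.
Qed.

End TensorMapsTheory.

Record dgBocs (S : pzRingType) := DgBocs {
  bocsC :> grBimodType S;
  mu : bocsC -> tens bocsC bocsC;
  eps : bocsC -> S^o;
  delta : bocsC -> bocsC;
  mu_hom : is_grbihom 0 mu;
  eps_hom : is_grbihom 0 eps;
  delta_hom : is_grbihom 1 delta;
  mu_coassoc : forall c, tmap 0 mu id (mu c) = tassoc (tmap 0 id mu (mu c));
  mu_counitl : forall c, tlunit (tmap 0 eps id (mu c)) = c;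
  mu_counitr : forall c, trunit (tmap 0 id eps (mu c)) = c;
  mu_delta : forall c,
    mu (delta c) = tmap 1 id delta (mu c) + tmap 0 delta id (mu c);
  delta2 : forall c, delta (delta c) = 0
}.

(* The field k acts centrally on the bimodule C over S = k^n, where k sits in
   k^n diagonally. *)
Definition k_central (k : fieldType) (n : nat)
    (C : grBimodType {ffun 'I_n -> k}) : Prop :=
  forall (a : k) (c : C), [ffun => a] *: c = c *> [ffun => a].

Record is_grsub (S : pzRingType) (C : grBimodType S) (A : set C) : Prop := IsGrSub {
  grsub0 : A 0;
  grsubD : forall x y, A x -> A y -> A (x + y);
  grsubZ : forall (s : S) x, A x -> A (s *: x);
  grsubR : forall x (s : S), A x -> A (x *> s);
  grsub_hcomp : forall i x, A x -> A (hcomp i x)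
}.

(* The image in C ⊗ C of A ⊗ A, for a sub-bimodule A of C *)
Definition tens_sub (S : pzRingType) (C : grBimodType S) (A : set C)
    : set (tens C C) :=
  [set t | exists2 r : seq (C * C), (forall p, p \in r -> A p.1 /\ A p.2) &
             t = \sum_(p <- r) p.1 ⊗ p.2].

(* Normality: the decomposition C = S ⊕ Cbar is given by the inclusion nincl
   of S and the sub-bimodule Cbar. *)
Record normal (S : pzRingType) (B : dgBocs S) := Normal {
  nincl : S^o -> B;
  Cbar : set B;
  nincl_hom : is_grbihom 0 nincl;
  Cbar_sub : is_grsub Cbar;
  normal_dec : forall c : B,
    exists! p : S^o * B, Cbar p.2 /\ c = nincl p.1 + p.2;
  normal_eps : forall (s : S^o) (x : B), Cbar x -> eps (nincl s + x) = s;
  normal_mu : mu (nincl 1) = nincl 1 ⊗ nincl 1;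
  normal_delta : delta (nincl 1) = 0
}.

(* the element 1 of S, seen in C = S ⊕ Cbar *)
Definition bone (S : pzRingType) (B : dgBocs S) (N : normal B) : B := nincl N 1.

(* mubar is valued in the image of Cbar ⊗ Cbar, a direct summand of C ⊗ C;
   it is regarded here as a map to C ⊗ C. *)
Definition mubar (S : pzRingType) (B : dgBocs S) (N : normal B) (x : B)
    : tens B B := mu x - bone N ⊗ x - x ⊗ bone N.

Record triangular (S : pzRingType) (B : dgBocs S) := Triangular {
  tri_normal :> normal B;
  Cfilt : nat -> set B;
  Cfilt_sub : forall i, is_grsub (Cfilt i);
  Cfilt0 : Cfilt 0 = [set 0];
  Cfilt_chain : forall i, Cfilt i `<=` Cfilt i.+1;
  Cfilt_union : \bigcup_i Cfilt i = Cbar tri_normal;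
  Cfilt_mubar : forall i x, Cfilt i.+1 x ->
    tens_sub (Cfilt i) (mubar tri_normal x);
  Cfilt_delta : forall i x, Cfilt i.+1 x -> Cfilt i.+1 (delta x)
}.

(* The category GMod-B: a morphism M -> N of degree d is a map tens M B -> N
   satisfying is_grhom d. *)
Section GMod.
Variables (S : pzRingType) (B : dgBocs S).

Definition gcomp (M N L : grRModType S) (g : tens N B -> L) (f : tens M B -> N)
    : tens M B -> L :=
  fun t => g (tmap 0 f id (tassoc (tmap 0 id (@mu S B) t))).

Definition gid (M : grRModType S) : tens M B -> M :=
  tlift (fun m c => m *> (eps c : S)).

(* deltahat (f) = (-1)^(d + 1) f (id ⊗ delta), where d is the degree of f *)
Definition gdelta (M N : grRModType S) (d : int) (f : tens M B -> N)
    : tens M B -> N :=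
  fun t => zsign (d + 1) (f (tmap 1 id (@delta S B) t)).

Definition gfirst (N : normal B) (M L : grRModType S) (f : tens M B -> L)
    : M -> L := fun m => f (m ⊗ bone N).

Definition is_twisted (M : grRModType S) (u : tens M B -> M) : Prop :=
  is_grhom 1 u /\ forall t, gdelta 1 u t + gcomp u u t = 0.

Definition homotopically_trivial (M : grRModType S) (u : tens M B -> M) : Prop :=
  exists h : tens M B -> M, is_grhom (-1) h /\
    forall t, gid t = gdelta (-1) h t + gcomp u h t + gcomp h u t.

End GMod.

Definition cocycles (S : pzRingType) (M : grRModType S) (d : M -> M) (i : int)
    : set M := [set m | homog i m /\ d m = 0].
Definition coboundaries (S : pzRingType) (M : grRModType S) (d : M -> M) (i : int)
    : set M := d @` homog (i - 1).

Definition acyclic (S : pzRingType) (M : grRModType S) (d : M -> M) : Prop :=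
  forall i, cocycles d i = coboundaries d i.

(* Main.v *)
Require Import Defs.
From HB Require Import structures.
From mathcomp Require Import all_boot all_order all_algebra.
From mathcomp Require Import boolp classical_sets.
(* Write hat f = (f ⊗ id)(id ⊗ mu). By coassociativity hat turns the composition
   of GMod-B into composition of endomaps of M ⊗ C, and hat (f (id ⊗ delta)) is
   the graded commutator of hat f and D = id ⊗ delta. So u is twisted exactly when
   d = D + hat u has square 0, and h is a null-homotopy of the identity exactly
   when [d, hat h] = id. If u^0 is acyclic, semisimplicity of S gives a
   contraction h0 of (M, u^0); for h1 = h0 (id ⊗ eps) the map E = [d, hat h1]
   is the identity on M ⊗ 1, hence invertible by triangularity, and as it
   commutes with d, E^-1 (hat h1) comes from the required homotopy. *)

Set Implicit Arguments.
Unset Strict Implicit.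
Unset Printing Implicit Defensive.
Import GRing.Theory.
Local Open Scope ring_scope.
Local Open Scope classical_set_scope.

(** * Signs with integer exponents *)

Section Sign.
Variable V : zmodType.
Implicit Types (i j : int) (x : V).

Lemma odd_abszD i j : odd (absz (i + j)) = odd (absz i) (+) odd (absz j).
Proof.
have abs_nat (m n : nat) : odd (absz (m%:Z - n%:Z)) = odd m (+) odd n.
  case: (leqP n m) => h; first by rewrite subzn // absz_nat oddB.
  by rewrite -opprB abszN subzn 1?ltnW // absz_nat oddB 1?ltnW // addbC.
case: i j => m [] n.
- by rewrite -PoszD !absz_nat oddD.
- by rewrite NegzE abs_nat abszN absz_nat.
- by rewrite NegzE addrC abs_nat abszN !absz_nat addbC.
- by rewrite !NegzE -opprD !abszN -PoszD !absz_nat oddD.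
Qed.

Lemma zsignM i j x : zsign i (zsign j x) = zsign (i + j) x.
Proof. by rewrite /zsign odd_abszD; case: odd; case: odd; rewrite ?opprK. Qed.

Lemma zsign_parity i j x : odd (absz i) = odd (absz j) -> zsign i x = zsign j x.
Proof. by rewrite /zsign => ->. Qed.

End Sign.

(** * Homogeneous morphisms of graded modules *)

Section GradedHoms.
Variable S : pzRingType.

Lemma homog_ind (M : grRModType S) (P : M -> Prop) : P 0 ->
  (forall x y, P x -> P y -> P (x + y)) ->
  (forall i x, homog i x -> P x) -> forall x, P x.
Proof.
move=> P0 PD Ph x; have [r [_ [_ ->]]] := homog_dec x.
by apply: big_ind => // i _; apply: Ph; apply: hcomp_homog.
Qed.

Lemma koszul0 (M : grRModType S) (x : M) : koszul 0 x = x.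
Proof.
elim/homog_ind: x => [|x y hx hy|i x hx]; last by rewrite (koszul_homog _ hx) mul0r.
  by rewrite (@koszul_homog _ _ 0 0) ?mul0r // /homog /= hcomp0.
by rewrite koszulD hx hy.
Qed.

Lemma ract0r (M : rModType S) (x : M) : x *> (0 : S) = 0.
Proof. by apply: (addIr (x *> 0)); rewrite -ractDr !add0r. Qed.

Lemma homogD (M : grRModType S) i (x y : M) :
  homog i x -> homog i y -> homog i (x + y).
Proof. by rewrite /homog /= hcompD => -> ->. Qed.

Lemma homogN (M : grRModType S) i (x : M) : homog i x -> homog i (- x).
Proof. by rewrite /homog /= hcompN => ->. Qed.

Lemma homog_zsign (M : grRModType S) i j (x : M) : homog i x -> homog i (zsign j x).
Proof. by rewrite /zsign; case: odd => //; apply: homogN. Qed.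

Section Hom.
Variables (M N : grRModType S) (d : int) (f : M -> N).
Hypothesis hf : is_grhom d f.

Lemma grhom0 : f 0 = 0.
Proof. by apply: (addIr (f 0)); rewrite -(grhomD hf) !add0r. Qed.

Lemma grhomN : {morph f : x / - x}.
Proof. by move=> x; apply: (addIr (f x)); rewrite -(grhomD hf) !addNr grhom0. Qed.

Lemma grhomB : {morph f : x y / x - y}.
Proof. by move=> x y; rewrite (grhomD hf) grhomN. Qed.

Lemma grhom_zsign i x : f (zsign i x) = zsign i (f x).
Proof. by rewrite /zsign; case: odd => //; apply: grhomN. Qed.

(** This equational form of homogeneity is what makes kernels graded submodules and inverses of
    bijective morphisms homogeneous. *)
Lemma grhom_hcomp i x : f (hcomp i x) = hcomp (i + d) (f x).
Proof.
elim/homog_ind: x => [|x y hx hy|j x hx].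
- by rewrite grhom0 !hcomp0 grhom0.
- by rewrite hcompD !(grhomD hf) hcompD hx hy.
- rewrite (hcomp_homogE _ hx) (hcomp_homogE _ (grhom_deg hf hx)).
  by rewrite (inj_eq (addIr d)); case: ifP; rewrite ?grhom0.
Qed.

End Hom.

Lemma id_hom (M : grRModType S) : is_grhom 0 (@id M).
Proof. by split=> // i x; rewrite addr0. Qed.

Lemma id_bihom (M : grBimodType S) : is_grbihom 0 (@id M).
Proof. by split=> //; apply: id_hom. Qed.

Lemma comp_hom (M N L : grRModType S) d e (g : N -> L) (f : M -> N) :
  is_grhom e g -> is_grhom d f -> is_grhom (d + e) (fun x => g (f x)).
Proof.
move=> hg hf; split=> [x y|x s|i x hx].
- by rewrite (grhomD hf) (grhomD hg).
- by rewrite (grhomR hf) (grhomR hg).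
- by rewrite addrA; apply/(grhom_deg hg)/(grhom_deg hf).
Qed.

Lemma add_hom (M N : grRModType S) d (f g : M -> N) :
  is_grhom d f -> is_grhom d g -> is_grhom d (fun x => f x + g x).
Proof.
move=> hf hg; split=> [x y|x s|i x hx].
- by rewrite (grhomD hf) (grhomD hg) addrACA.
- by rewrite (grhomR hf) (grhomR hg) ractDl.
- by apply: homogD; [apply: (grhom_deg hf)|apply: (grhom_deg hg)].
Qed.

Lemma opp_hom (M N : grRModType S) d (f : M -> N) :
  is_grhom d f -> is_grhom d (fun x => - f x).
Proof.
move=> hf; split=> [x y|x s|i x hx].
- by rewrite (grhomD hf) opprD.
- by rewrite (grhomR hf) ractNl.
- by apply/homogN/(grhom_deg hf).
Qed.

End GradedHoms.

(** * Morphisms out of a tensor product *)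

Section TensorHoms.
Variable S : pzRingType.

Section Pure.
Variables (M : grRModType S) (C : grBimodType S).

Lemma ract_pure (x : M) (y : C) (s : S) : (x ⊗ y) *> s = x ⊗ (y *> s).
Proof. exact: tens_ractE. Qed.

Lemma hcomp_pure n a b (x : M) (y : C) : homog a x -> homog b y ->
  hcomp n (x ⊗ y) = if n == a + b then x ⊗ y else 0.
Proof. exact: tens_hcompE. Qed.

Lemma homog_pure a b (x : M) (y : C) :
  homog a x -> homog b y -> homog (a + b) (x ⊗ y).
Proof. by move=> hx hy; rewrite /homog /= (hcomp_pure _ hx hy) eqxx. Qed.

Lemma additive0 (U V : zmodType) (F : U -> V) : {morph F : x y / x + y} -> F 0 = 0.
Proof. by move=> FD; apply: (addIr (F 0)); rewrite -FD !add0r. Qed.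

Lemma tens_ext (V : zmodType) (F G : tens M C -> V) :
  {morph F : x y / x + y} -> {morph G : x y / x + y} ->
  (forall x y, F (x ⊗ y) = G (x ⊗ y)) -> F =1 G.
Proof.
move=> FD GD FG; elim/tens_ind0 => [|t t' h h'|//]; last by rewrite FD GD h h'.
by rewrite !additive0.
Qed.

Lemma tens_hext (V : zmodType) (F G : tens M C -> V) :
  {morph F : x y / x + y} -> {morph G : x y / x + y} ->
  (forall a b x y, homog a x -> homog b y -> F (x ⊗ y) = G (x ⊗ y)) -> F =1 G.
Proof.
move=> FD GD FG; elim/tens_hind => [|t t' h h'|//]; last by rewrite FD GD h h'.
by rewrite !additive0.
Qed.

(** A homogeneous tensor need not be presented by homogeneous pure tensors, so the degree condition
    cannot be read off a presentation. Commutation with [hcomp] is additive in the tensor, hence can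
    be tested on pure tensors, and it implies the degree condition. *)
Lemma tens_grhom (N : grRModType S) d (F : tens M C -> N) :
  {morph F : t t' / t + t'} ->
  (forall x y s, F (x ⊗ (y *> s)) = F (x ⊗ y) *> s) ->
  (forall a b x y, homog a x -> homog b y -> homog (a + b + d) (F (x ⊗ y))) ->
  is_grhom d F.
Proof.
move=> FD FR Fh; split=> // [t s|i t].
  move: t; apply: tens_ext => [t t'|t t'|x y]; rewrite ?(ractDl, FD) //.
  by rewrite ract_pure FR.
have e : F (hcomp i t) = hcomp (i + d) (F t).
  move: t; apply: tens_hext => [t t'|t t'|a b x y hx hy].
  - by rewrite hcompD FD.
  - by rewrite FD hcompD.
  rewrite (hcomp_pure _ hx hy) (hcomp_homogE _ (Fh _ _ _ _ hx hy)).
  by rewrite (inj_eq (addIr d)); case: ifP => // _; apply: additive0.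
by move=> ht; rewrite /homog /= -e ht.
Qed.

End Pure.

Lemma tmap_hom (M N : grRModType S) (C D : grBimodType S) d (e e' : int)
    (f : M -> N) (g : C -> D) : is_grhom d f -> is_grbihom e' g ->
  is_grhom (d + e') (tmap e f g).
Proof.
move=> hf hg; have b := tmap_bal e hf hg; apply: tens_grhom.
- exact: tliftD b.
- by move=> x y s; rewrite /tmap !(tliftE b) ract_pure (grhomR (grbihom_hom hg)).
- move=> i j x y hx hy; rewrite (tmapE _ _ hf hg hx); apply: homog_zsign.
  rewrite addrACA; apply: homog_pure; first exact: grhom_deg hf _ _ hx.
  exact: grhom_deg (grbihom_hom hg) _ _ hy.
Qed.

Lemma tmap0E (M N : grRModType S) (C D : grBimodType S) d (e' : int)
    (f : M -> N) (g : C -> D) x y : is_grhom d f -> is_grbihom e' g ->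
  tmap 0 f g (x ⊗ y) = f x ⊗ g y.
Proof. by move=> hf hg; rewrite /tmap (tliftE (tmap_bal 0 hf hg)) koszul0. Qed.

End TensorHoms.

(** * Morphisms of GMod-B as maps of tensor products with C *)

Section Hat.
Variables (S : pzRingType) (B : dgBocs S).

Definition hat (M N : grRModType S) (f : tens M B -> N) (t : tens M B) : tens N B :=
  tmap 0 f id (tassoc (tmap 0 id (@mu S B) t)).

(** In Sweedler notation [hat f (m ⊗ c)] is Σ f (m ⊗ c1) ⊗ c2. Here [mu c] is replaced by an
    arbitrary tensor [w], so that identities about [hat] can be tested on pure tensors y ⊗ z. *)
Definition slice (M N : grRModType S) (f : tens M B -> N) (m : M) (w : tens B B) :
  tens N B := tlift (fun y z => f (m ⊗ y) ⊗ z) w.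

Definition codiff (M : grRModType S) : tens M B -> tens M B :=
  tmap 1 id (@delta S B).

Section Slice.
Variables (M N : grRModType S) (d : int) (f : tens M B -> N).
Hypothesis hf : is_grhom d f.

Lemma slice_bal m : balanced (fun y z : B => f (m ⊗ y) ⊗ z).
Proof.
split=> [y y' z|y z z'|y s z]; rewrite ?tpureDr ?(grhomD hf) ?tpureDl //.
by rewrite -ract_pure (grhomR hf) tpure_bal.
Qed.

Lemma sliceD m : {morph slice f m : w w' / w + w'}.
Proof. exact: tliftD (slice_bal m). Qed.

Lemma slice_pure m y z : slice f m (y ⊗ z) = f (m ⊗ y) ⊗ z.
Proof. exact: tliftE (slice_bal m) y z. Qed.

Lemma sliceR m w s : slice f m (w *> s) = slice f m w *> s.
Proof.
move: w; apply: tens_ext => [w w'|w w'|y z]; rewrite ?(ractDl, sliceD) //.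
by rewrite ract_pure !slice_pure ract_pure.
Qed.

Lemma slice_hom i m : homog i m -> is_grhom (i + d) (slice f m).
Proof.
move=> hm; apply: tens_grhom; first exact: sliceD.
  by move=> y z s; rewrite -ract_pure sliceR.
move=> a b y z hy hz; rewrite slice_pure.
have -> : a + b + (i + d) = (i + a + d) + b.
  by rewrite [i + a]addrC addrACA [b + d]addrC !addrA.
by apply: homog_pure hz; apply/(grhom_deg hf)/homog_pure.
Qed.

Lemma hatD : {morph hat f : t t' / t + t'}.
Proof.
move=> t t'; rewrite /hat (grhomD (tmap_hom 0 (id_hom M) (mu_hom B))).
rewrite [tassoc _](tliftD (@tassoc_bal2 _ M B B)).
by rewrite (grhomD (tmap_hom 0 hf (id_bihom B))).
Qed.

Lemma hatE m c : hat f (m ⊗ c) = slice f m (mu c).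
Proof.
rewrite /hat (tmap0E _ _ (id_hom M) (mu_hom B)).
rewrite /tassoc (tliftE (@tassoc_bal2 _ M B B)).
have b := @tassoc_bal1 _ M B B m.
move: (mu c); apply: tens_ext => [w w'|w w'|y z].
- by rewrite (tliftD b) (grhomD (tmap_hom 0 hf (id_bihom B))).
- exact: sliceD.
- by rewrite (tliftE b) (tmap0E _ _ hf (id_bihom B)) slice_pure.
Qed.

Lemma hat_hom : is_grhom d (hat f).
Proof.
apply: tens_grhom; first exact: hatD.
  move=> m c s; rewrite !hatE (grhomR (grbihom_hom (mu_hom B))).
  exact: sliceR.
move=> a b m c hm hc; rewrite hatE -addrA addrCA.
apply: (grhom_deg (slice_hom hm)).
by rewrite -[b]addr0; apply: (grhom_deg (grbihom_hom (mu_hom B))).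
Qed.

End Slice.

Lemma codiff_hom (M : grRModType S) : is_grhom 1 (@codiff M).
Proof. by have := tmap_hom 1 (id_hom M) (delta_hom B); rewrite add0r. Qed.

Lemma codiff_pure (M : grRModType S) i (m : M) (c : B) : homog i m ->
  codiff (m ⊗ c) = zsign i (m ⊗ delta c).
Proof.
by move=> hm; rewrite /codiff (tmapE _ _ (id_hom M) (delta_hom B) hm) mul1r.
Qed.

Lemma codiff2 (M : grRModType S) (t : tens M B) : codiff (codiff t) = 0.
Proof.
have cD := grhomD (@codiff_hom M).
move: t; apply: tens_hext => [t t'|t t'|a b m c hm hc].
- by rewrite !cD.
- by rewrite addr0.
rewrite (codiff_pure _ hm) (grhom_zsign (@codiff_hom M)) (codiff_pure _ hm).
by rewrite delta2 tpure0r !zsign0.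
Qed.

Lemma gcompE (M N L : grRModType S) (g : tens N B -> L) (f : tens M B -> N) t :
  gcomp g f t = g (hat f t).
Proof. by []. Qed.

Lemma gcomp_hom (M N L : grRModType S) d e (g : tens N B -> L) (f : tens M B -> N) :
  is_grhom e g -> is_grhom d f -> is_grhom (d + e) (gcomp g f).
Proof. by move=> hg hf; apply: comp_hom hg (hat_hom hf). Qed.

(* Both sides are Σ g (f (m ⊗ c1) ⊗ c2) ⊗ c3, by coassociativity. *)
Lemma hat_gcomp (M N L : grRModType S) d e (g : tens N B -> L) (f : tens M B -> N) :
  is_grhom e g -> is_grhom d f -> forall t, hat (gcomp g f) t = hat g (hat f t).
Proof.
move=> hg hf; have hgf := gcomp_hom hg hf; apply: tens_ext => [t t'|t t'|m c].
- exact: hatD hgf _ _.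
- by rewrite (hatD hf) (hatD hg).
rewrite (hatE hgf) (hatE hf).
(* [K] sends (a ⊗ b) ⊗ z to g (f (m ⊗ a) ⊗ b) ⊗ z. Both sides are [K] of one of the two iterated
   coproducts of [c]. *)
pose K (T : tens (tens B B) B) : tens L B :=
  tlift (fun (w : tens B B) z => g (slice f m w) ⊗ z) T.
have bK : balanced (fun (w : tens B B) (z : B) => g (slice f m w) ⊗ z).
  split=> [w w' z|w z z'|w s z].
  - by rewrite (sliceD hf) (grhomD hg) tpureDl.
  - exact: tpureDr.
  - rewrite -tpure_bal -(grhomR hg); congr (g _ ⊗ _).
    have sf := sliceD hf m.
    move: w; apply: tens_ext => [w w'|w w'|y y']; rewrite ?ractDl ?sf ?ractDl //.
    by rewrite ract_pure !(slice_pure hf) ract_pure.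
have KD : {morph K : T T' / T + T'} by exact: tliftD bK.
have KE w z : K (w ⊗ z) = g (slice f m w) ⊗ z by exact: tliftE bK w z.
have tmap_id := tmap_hom 0 (id_hom B) (mu_hom B).
have tassocD := tliftD (@tassoc_bal2 _ B B B).
have tm := tmap_hom 0 (grbihom_hom (mu_hom B)) (id_bihom B).
transitivity (K (tmap 0 (@mu S B) id (mu c))).
  move: (mu c); apply: tens_ext => [w w'|w w'|y z].
  - exact: sliceD hgf _ _ _.
  - by rewrite (grhomD tm) KD.
  - rewrite (slice_pure hgf) (tmap0E _ _ (grbihom_hom (mu_hom B)) (id_bihom B)) KE.
    by rewrite gcompE (hatE hf).
rewrite mu_coassoc; move: (mu c); apply: tens_ext => [w w'|w w'|y z].
- by rewrite (grhomD tmap_id) [tassoc _]tassocD KD.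
- by rewrite (sliceD hf) (hatD hg).
rewrite (slice_pure hf) (hatE hg) (tmap0E _ _ (id_hom B) (mu_hom B)).
move: (mu z); apply: tens_ext => [w w'|w w'|a b].
- by rewrite tpureDr [tassoc _]tassocD KD.
- exact: sliceD hg _ _ _.
- by rewrite tassocE KE !(slice_pure hf) (slice_pure hg).
Qed.

(** Expand [mu (delta c)] by the coderivation rule: the term with [delta] on the left factor is the
    left-hand side, and the term with [delta] on the right factor is, up to sign, [codiff] applied
    after [hat f]. *)
Lemma hat_codiff (M N : grRModType S) d (f : tens M B -> N) : is_grhom d f ->
  forall t, hat (fun t => f (codiff t)) t = hat f (codiff t) - zsign d (codiff (hat f t)).
Proof.
move=> hf; have hfc := comp_hom hf (@codiff_hom M).
have cM := @codiff_hom M; have cN := @codiff_hom N.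
apply: tens_hext => [t t'|t t'|i b m c hm _].
- exact: hatD hfc _ _.
- by rewrite (grhomD cM) !(hatD hf) (grhomD cN) zsignD opprD addrACA.
rewrite (hatE hfc) (codiff_pure _ hm) (grhom_zsign (hat_hom hf)) !(hatE hf).
rewrite mu_delta (sliceD hf) zsignD.
have hid := tmap_hom 1 (id_hom B) (delta_hom B).
have hdel := tmap_hom 0 (grbihom_hom (delta_hom B)) (id_bihom B).
have -> : slice (fun t => f (codiff t)) m (mu c) =
    zsign i (slice f m (tmap 0 (@delta S B) id (mu c))).
  move: (mu c); apply: tens_ext => [w w'|w w'|y z].
  - exact: sliceD hfc _ _ _.
  - by rewrite (grhomD hdel) (sliceD hf) zsignD.
  - rewrite (slice_pure hfc) (codiff_pure _ hm) (grhom_zsign hf).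
    rewrite (tmap0E _ _ (grbihom_hom (delta_hom B)) (id_bihom B)) (slice_pure hf).
    by rewrite /zsign; case: odd; rewrite ?tpureNl.
have -> : zsign i (slice f m (tmap 1 id (@delta S B) (mu c))) =
    zsign d (codiff (slice f m (mu c))).
  move: (mu c); apply: tens_hext => [w w'|w w'|j l y z hy _].
  - by rewrite (grhomD hid) (sliceD hf) zsignD.
  - by rewrite (sliceD hf) (grhomD cN) zsignD.
  - rewrite (tmapE _ _ (id_hom B) (delta_hom B) hy) mul1r (grhom_zsign (slice_hom hf hm)).
    rewrite !(slice_pure hf) (codiff_pure _ (grhom_deg hf (homog_pure hm hy))).
    (* The exponents are i + j and d + (i + j + d): on the right, [delta] passes f (m ⊗ y), of
       degree i + j + d. *)
    rewrite !zsignM; apply: zsign_parity; rewrite !odd_abszD.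
    by case: odd; case: odd; case: odd.
by rewrite addrAC subrr add0r.
Qed.

Lemma gid_bal (M : grRModType S) : balanced (fun (m : M) (c : B) => m *> (eps c : S)).
Proof.
have e := eps_hom B; split=> [m m' c|m c c'|m s c].
- exact: ractDl.
- by rewrite (grhomD (grbihom_hom e)) ractDr.
- by rewrite (grbihomL e) ractA.
Qed.

Lemma gidE (M : grRModType S) (m : M) (c : B) : gid (m ⊗ c) = m *> (eps c : S).
Proof. exact: tliftE (gid_bal M) m c. Qed.

Lemma gid_hom (M : grRModType S) : is_grhom 0 (@gid S B M).
Proof.
have e := grbihom_hom (eps_hom B); apply: tens_grhom.
- exact: tliftD (gid_bal M).
- by move=> m c s; rewrite !gidE (grhomR e) ractA.
move=> a b m c hm hc; rewrite gidE addr0.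
have := grhom_deg e hc; rewrite addr0 /homog /= {1}/hcomp /= /reg_hcomp.
(* As S is concentrated in degree 0, either b = 0 or [eps c] vanishes. *)
case: eqP => [-> _|_ <-]; first by rewrite addr0 hcomp_ract hm.
by rewrite ract0r hcomp0.
Qed.

(** By the right counit law [f] can be recovered from [hat f], so equations between morphisms may be
    proved after applying [hat]. *)
Lemma gid_hat (M N : grRModType S) d (f : tens M B -> N) :
  is_grhom d f -> forall t, gid (hat f t) = f t.
Proof.
move=> hf; have gM := gid_hom N; apply: tens_ext => [t t'|t t'|m c].
- by rewrite (hatD hf) (grhomD gM).
- exact: grhomD hf _ _.
rewrite (hatE hf) -{2}(mu_counitr c).
have he := tmap_hom 0 (id_hom B) (eps_hom B).
have bt : balanced (fun (x : B) (s : S^o) => x *> (s : S)).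
  by split=> *; rewrite ?ractDl ?ractDr ?ractA.
move: (mu c); apply: tens_ext => [w w'|w w'|y z].
- by rewrite (sliceD hf) (grhomD gM).
- by rewrite (grhomD he) [trunit _](tliftD bt) tpureDr (grhomD hf).
rewrite (slice_pure hf) gidE (tmap0E _ _ (id_hom B) (eps_hom B)) trunitE.
by rewrite -ract_pure (grhomR hf).
Qed.

Lemma hat_gid (M : grRModType S) (t : tens M B) : hat (@gid S B M) t = t.
Proof.
have g := gid_hom M; move: t; apply: tens_ext => // [t t'|m c].
  exact: hatD g _ _.
rewrite (hatE g) -{2}(mu_counitl c).
have he := tmap_hom 0 (grbihom_hom (eps_hom B)) (id_bihom B).
have bt : balanced (fun (s : S^o) (y : B) => (s : S) *: y).
  by split=> *; rewrite ?scalerDl ?scalerDr ?scalerA.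
move: (mu c); apply: tens_ext => [w w'|w w'|y z].
- exact: sliceD g _ _ _.
- by rewrite (grhomD he) [tlunit _](tliftD bt) tpureDr.
rewrite (slice_pure g) gidE (tmap0E _ _ (grbihom_hom (eps_hom B)) (id_bihom B)).
by rewrite tlunitE tpure_bal.
Qed.

Lemma hat_add (M N : grRModType S) d (f g : tens M B -> N) :
  is_grhom d f -> is_grhom d g ->
  forall t, hat (fun t => f t + g t) t = hat f t + hat g t.
Proof.
move=> hf hg; have hfg := add_hom hf hg; apply: tens_ext => [t t'|t t'|m c].
- exact: hatD hfg _ _.
- by rewrite (hatD hf) (hatD hg) addrACA.
rewrite (hatE hfg) (hatE hf) (hatE hg).
move: (mu c); apply: tens_ext => [w w'|w w'|y z].
- exact: sliceD hfg _ _ _.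
- by rewrite (sliceD hf) (sliceD hg) addrACA.
- by rewrite (slice_pure hfg) (slice_pure hf) (slice_pure hg) tpureDl.
Qed.

Lemma eq_hat (M N : grRModType S) (f g : tens M B -> N) : f =1 g -> hat f =1 hat g.
Proof. by move=> /funext ->. Qed.

End Hat.

(** * Graded submodules, complements and contractions over a product of fields *)

Record grsubmod (S : pzRingType) (M : grRModType S) (A : set M) : Prop := GrSubmod {
  grsubmod0 : A 0;
  grsubmod_lin : forall x y (s : S), A x -> A y -> A (x + y *> s);
  grsubmod_hcomp : forall i x, A x -> A (hcomp i x)
}.

Section Submodules.
Variables (S : pzRingType) (M : grRModType S) (A : set M).
Hypothesis sA : grsubmod A.

Lemma grsubmodD x y : A x -> A y -> A (x + y).
Proof. by move=> hx hy; rewrite -[y](@ract1 S); apply: grsubmod_lin. Qed.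

Lemma grsubmodR x s : A x -> A (x *> s).
Proof. by move=> hx; rewrite -[x *> s]add0r; apply: grsubmod_lin (grsubmod0 sA) hx. Qed.

Lemma grsubmodB x y : A x -> A y -> A (x - y).
Proof.
move=> hx hy; rewrite -[y](@ract1 S) -ractNl.
have -> : - y *> (1 : S) = y *> (- 1 : S).
  by apply: (addIr (y *> 1)); rewrite -ractDl -ractDr !addNr ract0l ract0r.
exact: grsubmod_lin.
Qed.

End Submodules.

Section Complement.
Variables (k : fieldType) (n : nat).
Local Notation S := {ffun 'I_n -> k}.

Let e (j : 'I_n) : S := [ffun i => (i == j)%:R].

(** On the block of e_j only the coordinate [s j] acts, so y S is spanned by y over k. *)
Let ract_e (M : grRModType S) j (y : M) (s : S) : y *> e j = y ->
  y *> s = y *> (e j * [ffun=> s j]).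
Proof.
move=> hy; rewrite -{1}hy ractA; congr (_ *> _); apply/ffunP => i; rewrite !ffunE.
by have [->|_] := eqVneq i j; rewrite ?mul0r.
Qed.

(* Semisimplicity of a product of fields. In a maximal graded W with W ∩ Z = 0,
   a homogeneous y = y e_j outside Z + W could be adjoined, since
   y S = y k is a line. *)
Lemma graded_complement (M : grRModType S) (Z : set M) : grsubmod Z ->
  exists2 W : set M, grsubmod W &
    (forall x, W x -> Z x -> x = 0) /\
    (forall x, exists z w, [/\ Z z, W w & x = z + w]).
Proof.
move=> sZ.
(* Membership of 0 is left out of [P], because Zorn's lemma also considers the empty chain, whose
   union is empty. It is recovered by maximality: since x - x lies in W for every x in W, a W
   without 0 would be empty, hence strictly inside {0}. *)
pose P (A : set M) := [/\ forall x y (s : S), A x -> A y -> A (x + y *> s),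
  forall i x, A x -> A (hcomp i x) & forall x, A x -> Z x -> x = 0].
have [F FP totF|W [[Wlin Whc WZ] maxW]] := @Zorn_bigcup M P.
  split=> [x y s [X FX Xx] [Y FY Yy]|i x [X FX Xx]|x [X FX Xx]].
  - have [XY|YX] := totF _ _ FX FY.
      by exists Y => //; have [+ _ _] := FP _ FY; apply=> //; apply: XY.
    by exists X => //; have [+ _ _] := FP _ FX; apply=> //; apply: YX.
  - by exists X => //; have [_ + _] := FP _ FX; apply.
  - by have [_ _ +] := FP _ FX; apply.
have W0 : W 0.
  apply: contrapT => nW0; apply: (maxW [set 0]).
    split=> [x Wx|]; last by move=> /(_ 0 erefl).
    case: nW0; have := Wlin _ _ (- 1 : S) Wx Wx.
    by rewrite -{1}[x](@ract1 S) -ractDr subrr ract0r.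
  split=> [x y s -> ->|i x ->|x -> //]; last exact: hcomp0.
  by rewrite ract0l; exact: addr0.
have sW : grsubmod W by [].
exists W => //; split=> //.
pose Q x := exists z w, [/\ Z z, W w & x = z + w].
have sQ x y s : Q x -> Q y -> Q (x + y *> s).
  move=> [z [w [Zz Ww ->]]] [z' [w' [Zz' Ww' ->]]].
  exists (z + z' *> s), (w + w' *> s); split; [exact: grsubmod_lin|exact: Wlin|].
  by rewrite ractDl addrACA.
have QZ z : Z z -> Q z by exists z, 0; split=> //; rewrite addr0.
have QW w : W w -> Q w.
  by exists 0, w; split=> //; [exact: grsubmod0 sZ|rewrite add0r].
have Q0 : Q 0 by apply: QW.
have QD x y : Q x -> Q y -> Q (x + y).
  by move=> hx hy; rewrite -[y](@ract1 S); apply: sQ.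
have QR x s : Q x -> Q (x *> s) by move=> hx; rewrite -[_ *> s]add0r; apply: sQ.
(* Homogeneous components and the decomposition of 1 into the idempotents e_j reduce the claim to a
   homogeneous y in a single block. *)
suff Qline i j y : homog i y -> y *> e j = y -> Q y.
  elim/homog_ind => // i x hx.
  have -> : x = \sum_j x *> e j.
    rewrite -{1}[x](@ract1 S).
    have -> : (1 : S) = \sum_j e j.
      apply/ffunP => a; rewrite sum_ffunE ffunE (bigD1 a) //= ffunE eqxx.
      by rewrite big1 ?addr0 // => b /negPf ba; rewrite ffunE eq_sym ba.
    by apply: (big_morph _ (@ractDr S M x) (@ract0r S M x)).
  apply: (big_ind Q) => // j _; apply: (Qline i j).
    by rewrite /homog /= hcomp_ract hx.
  by rewrite ractA; congr (_ *> _); apply/ffunP => a; rewrite !ffunE -natrM mulnb andbb.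
move=> hy ye; apply: contrapT => nQy.
apply: (maxW [set x | exists w s, W w /\ x = w + y *> s]).
  split=> [w Ww|sub]; first by exists w, 0; rewrite ract0r addr0.
  by apply/nQy/QW/sub; exists 0, 1; rewrite ract1 add0r.
split=> [_ _ t [w [s [Ww ->]]] [w' [s' [Ww' ->]]]|l _ [w [s [Ww ->]]]|
         _ [w [s [Ww ->]]] Zx].
- exists (w + w' *> t), (s + s' * t); split; first exact: Wlin.
  by rewrite ractDl ractDr ractA addrACA.
- exists (hcomp l w), (if l == i then s else 0); split; first exact: Whc.
  rewrite hcompD hcomp_ract (hcomp_homogE _ hy).
  by case: ifP => // _; rewrite ract0l ract0r.
(* The set W + y S still meets Z trivially. If [s j] is 0 the element is already in W. Otherwise y s
   = (w + y s) - w lies in Z + W, and dividing by [s j] puts y there, against the choice of y. *)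
have [sj0|sj0] := eqVneq (s j) 0.
  have ys0 : y *> s = 0.
    rewrite (ract_e s ye) sj0.
    have -> : [ffun=> 0] = 0 :> S by apply/ffunP => a; rewrite !ffunE.
    by rewrite mulr0 ract0r.
  by move: Zx; rewrite ys0 addr0; apply: WZ.
case: nQy; have -> : y = (y *> s) *> [ffun=> (s j)^-1].
  rewrite (ract_e s ye) ractA -mulrA -[LHS]ye; congr (_ *> _).
  by apply/ffunP => a; rewrite !ffunE mulfV ?mulr1.
apply: QR; have -> : y *> s = (w + y *> s) + w *> (- 1 : S).
  rewrite -{1}[w](@ract1 S) addrAC -ractDr subrr ract0r add0r //.
by apply: sQ; [apply: QZ|apply: QW].
Qed.

(** Let W be a graded complement of Z = ker d. By acyclicity d maps W bijectively onto Z, and the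
    contraction projects onto Z along W and then inverts d. Thus h x is the unique w in W with x - d
    w in W. *)
Lemma acyclic_contractible (M : grRModType S) (d : M -> M) : is_grhom 1 d ->
  (forall x, d (d x) = 0) -> acyclic d ->
  exists2 h : M -> M, is_grhom (- 1) h & forall x, d (h x) + h (d x) = x.
Proof.
move=> hd dd ac; pose Z := [set x | d x = 0].
have sZ : grsubmod Z.
  split=> [|x y s|i x]; rewrite /Z /= ?(grhom0 hd) //.
    by move=> dx dy; rewrite (grhomD hd) (grhomR hd) dx dy ract0l addr0.
  by move=> dx; rewrite (grhom_hcomp hd) dx hcomp0.
(* Acyclicity speaks of homogeneous cocycles; a general cycle is the sum of its components, which
   are again cycles. *)
have Zim z : Z z -> exists y, z = d y.
  move=> Zz; have [r [_ [_ ->]]] := homog_dec z.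
  apply: (big_ind (fun z => exists y, z = d y)) => [|x x' [y ->] [y' ->]|i _].
  - by exists 0; rewrite (grhom0 hd).
  - by exists (y + y'); rewrite (grhomD hd).
  have : cocycles d i (hcomp i z).
    by split; [exact: hcomp_homog|exact: grsubmod_hcomp sZ _ _ Zz].
  by rewrite ac => -[y _ <-]; exists y.
have [W sW [WZ ZW]] := graded_complement sZ.
have WB := grsubmodB sW.
have /choice[h hP] : forall x, exists w, W w /\ W (x - d w).
  move=> x; have [z [w0 [/Zim[y ->] Ww0 ->]]] := ZW x.
  have [z' [w [Zz' Ww ->]]] := ZW y.
  by exists w; split=> //; rewrite (grhomD hd) Zz' add0r addrAC subrr add0r.
have hW x : W (h x) := proj1 (hP x).
(* The element d (h x) - d w lies both in W and in Z, so it is 0; then h x - w lies in W and in Z as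
   well. *)
have huniq x w : W w -> W (x - d w) -> h x = w.
  move=> Ww Wxw; have [Wh Wxh] := hP x; apply/subr0_eq/WZ; first exact: WB.
  rewrite /Z /=; apply: WZ; last by rewrite /Z /= dd.
  rewrite (grhomB hd) -(_ : (x - d w) - (x - d (h x)) = d (h x) - d w); last first.
    by rewrite opprB addrC addrA subrK.
  exact: WB.
exists h => [|x].
  (* Additivity, S-linearity and homogeneity of h all follow from uniqueness. *)
  split=> [x y|x s|i x hx]; [apply: huniq|apply: huniq|symmetry; apply: huniq].
  - exact: grsubmodD.
  - rewrite (grhomD hd) opprD addrACA.
    by apply: (grsubmodD sW); [have [] := hP x|have [] := hP y].
  - exact: grsubmodR.
  - by rewrite (grhomR hd) -ractNl -ractDl; apply: (grsubmodR sW); have [] := hP x.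
  - exact: grsubmod_hcomp.
  - rewrite (grhom_hcomp hd) subrK -{1}hx -hcompN -hcompD.
    by apply: (grsubmod_hcomp sW); have [] := hP x.
have -> : h (d x) = x - d (h x); last by rewrite addrC subrK.
apply: huniq; first by have [] := hP x.
by rewrite (grhomB hd) dd subr0 subrr; apply: grsubmod0.
Qed.

End Complement.

(** * Restriction to M ⊗ 1: first components *)

Section FirstComponent.
Variables (S : pzRingType) (B : dgBocs S) (T : normal B).

Lemma scale_bone s : s *: bone T = bone T *> s.
Proof.
rewrite /bone -(grbihomL (nincl_hom T)) -(grhomR (grbihom_hom (nincl_hom T))).
by congr (nincl T _); rewrite [LHS]mulr1 [RHS]mul1r.
Qed.

Lemma homog_bone : homog 0 (bone T).
Proof.
rewrite -[0](addr0 (0 : int)); apply: (grhom_deg (grbihom_hom (nincl_hom T))).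
by rewrite /homog /= /hcomp /= /reg_hcomp eqxx.
Qed.

Lemma eps_bone : eps (bone T) = 1.
Proof. by rewrite -[bone T]addr0; apply/normal_eps/(grsub0 (Cbar_sub T)). Qed.

Lemma gid_bone (M : grRModType S) (m : M) : gid (m ⊗ bone T) = m.
Proof. by rewrite gidE eps_bone ract1. Qed.

Lemma codiff_bone (M : grRModType S) (m : M) : codiff (m ⊗ bone T) = 0.
Proof.
rewrite /codiff /tmap (tliftE (tmap_bal 1 (id_hom M) (delta_hom B))).
by rewrite normal_delta tpure0r.
Qed.

Section Hom.
Variables (M N : grRModType S) (d : int) (f : tens M B -> N).
Hypothesis hf : is_grhom d f.

(** Since 1 is grouplike, [hat f] maps M ⊗ 1 to N ⊗ 1 and acts there as the first component of
    [f]. *)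
Lemma hat_bone m : hat f (m ⊗ bone T) = gfirst T f m ⊗ bone T.
Proof. by rewrite (hatE hf) normal_mu (slice_pure hf). Qed.

Lemma gfirst_hom : is_grhom d (gfirst T f).
Proof.
split=> [x y|x s|i x hx]; rewrite /gfirst.
- by rewrite tpureDl (grhomD hf).
- by rewrite tpure_bal scale_bone -ract_pure (grhomR hf).
- by apply: (grhom_deg hf); rewrite -[i]addr0; apply/homog_pure/homog_bone.
Qed.

End Hom.

Lemma gfirst_gcomp (M N L : grRModType S) d (g : tens N B -> L) (f : tens M B -> N) :
  is_grhom d f -> forall m, gfirst T (gcomp g f) m = gfirst T g (gfirst T f m).
Proof. by move=> hf m; rewrite /gfirst gcompE (hat_bone hf). Qed.

End FirstComponent.

(** * Triangularity and unipotent endomorphisms of M ⊗ C *)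

Section Unipotent.
Variables (S : pzRingType) (B : dgBocs S) (T : triangular B) (M : grRModType S).

(** This is the image of M ⊗ (S ⊕ C_i) in M ⊗ C, where C_i is [Cfilt T i]. Signs and elements of S
    are absorbed by m, so closing under sums suffices. The summand M ⊗ 1 belongs to every level, and
    level 0 is just M ⊗ 1. *)
Inductive tens_filt (i : nat) : tens M B -> Prop :=
| tens_filt_bone m : tens_filt i (m ⊗ bone T)
| tens_filt_pure m c of Cfilt T i c : tens_filt i (m ⊗ c)
| tens_filt_add t t' of tens_filt i t & tens_filt i t' : tens_filt i (t + t').

Lemma tens_filt_zero i : tens_filt i 0.
Proof. by rewrite -(tpure0l M (bone T)); apply: tens_filt_bone. Qed.

Lemma tens_filt_opp i t : tens_filt i t -> tens_filt i (- t).
Proof.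
elim=> [m|m c hc|t1 t2 _ h1 _ h2]; last by rewrite opprD; apply: tens_filt_add.
  by rewrite -tpureNl; apply: tens_filt_bone.
by rewrite -tpureNl; apply: tens_filt_pure.
Qed.

Lemma Cfilt_le i j : (i <= j)%N -> Cfilt T i `<=` Cfilt T j.
Proof.
move=> /subnKC <-; elim: (j - i)%N => [|l IH]; first by rewrite addn0.
by rewrite addnS => c /IH; apply: Cfilt_chain.
Qed.

Lemma tens_filt_le i j t : (i <= j)%N -> tens_filt i t -> tens_filt j t.
Proof.
move=> ij; elim=> [m|m c hc|t1 t2 _ h1 _ h2]; first exact: tens_filt_bone.
  exact/tens_filt_pure/(Cfilt_le ij).
exact: tens_filt_add.
Qed.

Lemma tens_filt_exhaustive t : exists i, tens_filt i t.
Proof.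
elim/tens_ind0: t => [|t t' [i hi] [j hj]|m c].
  by exists 0%N; apply: tens_filt_zero.
  exists (maxn i j); apply: tens_filt_add.
    by apply: tens_filt_le hi; apply: leq_maxl.
  by apply: tens_filt_le hj; apply: leq_maxr.
have [[s x] [[/= Cx ->] _]] := normal_dec T c.
move: Cx; rewrite -Cfilt_union => -[i _ Cx]; exists i; rewrite tpureDr.
apply: tens_filt_add; last exact: tens_filt_pure.
have -> : nincl T s = (s : S) *: bone T.
  by rewrite -(grbihomL (nincl_hom T)); congr (nincl T _); rewrite [RHS]mulr1.
by rewrite -tpure_bal; apply: tens_filt_bone.
Qed.

Variable f : tens M B -> M.
Hypotheses (hf : is_grhom 0 f) (f0 : forall m, f (m ⊗ bone T) = 0).

Lemma hat_filt0 t : tens_filt 0 t -> hat f t = 0.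
Proof.
elim=> [m|m c|t1 t2 _ h1 _ h2].
- by rewrite (hat_bone _ hf) /gfirst f0 tpure0l.
- by rewrite Cfilt0 => ->; rewrite tpure0r (grhom0 (hat_hom hf)).
- by rewrite (hatD hf) h1 h2 addr0.
Qed.

(** Write [mu c] as [mubar] of c plus 1 ⊗ c plus c ⊗ 1. The term 1 ⊗ c dies because f vanishes on M
    ⊗ 1, the term c ⊗ 1 lands in M ⊗ 1, and [mubar] lowers the filtration by triangularity. Together
    with [hat_filt0] this makes [hat f] locally nilpotent. *)
Lemma hat_filtS i t : tens_filt i.+1 t -> tens_filt i (hat f t).
Proof.
elim=> [m|m c hc|t1 t2 _ h1 _ h2].
- by rewrite (hat_bone _ hf) /gfirst f0 tpure0l; apply: tens_filt_zero.
- have [r hr mur] := Cfilt_mubar hc.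
  rewrite (hatE hf).
  have -> : mu c = \sum_(p <- r) p.1 ⊗ p.2 + bone T ⊗ c + c ⊗ bone T.
    by rewrite -mur /mubar addrAC !subrK.
  rewrite 2!(sliceD hf) !(slice_pure hf) f0 tpure0l addr0.
  apply: tens_filt_add; last exact: tens_filt_bone.
  elim: r hr {mur} => [|p r IH] hr.
    by rewrite big_nil (additive0 (sliceD hf m)); apply: tens_filt_zero.
  rewrite big_cons (sliceD hf) (slice_pure hf); apply: tens_filt_add.
    by apply: tens_filt_pure; have [] := hr p (mem_head _ _).
  by apply: IH => q qr; apply: hr; rewrite inE qr orbT.
- by rewrite (hatD hf); apply: tens_filt_add.
Qed.

(** Such a t equals - [hat f t], so it drops one level at a time until it reaches level 0, where
    [hat f] is zero. *)
Lemma hat_unipotent_inj t : t + hat f t = 0 -> t = 0.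
Proof.
move/(canRL (addrK _)); rewrite add0r => tE.
have [i] := tens_filt_exhaustive t; elim: i => [|i IH] ht.
  by rewrite tE (hat_filt0 ht) oppr0.
by apply: IH; rewrite tE; apply/tens_filt_opp/hat_filtS.
Qed.

(** The preimage is the finite alternating sum of the iterates of [hat f] on t, built by induction:
    if s is a preimage of [hat f t], one level lower, then t - s is a preimage of t. *)
Lemma hat_unipotent_surj t : exists s, s + hat f s = t.
Proof.
have [i] := tens_filt_exhaustive t; elim: i t => [|i IH] t ht.
  by exists t; rewrite (hat_filt0 ht) addr0.
have [s sE] := IH _ (hat_filtS ht); exists (t - s).
by rewrite (grhomB (hat_hom hf)) addrACA -opprD sE addrK.
Qed.

End Unipotent.

Lemma bij_hom (S : pzRingType) (M : grRModType S) (f : M -> M) : is_grhom 0 f ->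
  (forall x, f x = 0 -> x = 0) -> (forall y, exists x, f x = y) ->
  exists g : M -> M, [/\ is_grhom 0 g, cancel f g & cancel g f].
Proof.
move=> hf finj /choice[g gK]; have fI : injective f.
  by move=> x y fxy; apply/subr0_eq/finj; rewrite (grhomB hf) fxy subrr.
have fK : cancel f g by move=> x; apply: fI; rewrite gK.
exists g; split=> //; split=> [x y|x s|i x hx].
  by apply: fI; rewrite (grhomD hf) !gK.
  by apply: fI; rewrite (grhomR hf) !gK.
by rewrite /homog /= addr0; apply: fI; rewrite (grhom_hcomp hf) gK addr0.
Qed.

(** * The differential on M ⊗ C and null-homotopies *)

Section Homotopy.
Variables (S : pzRingType) (B : dgBocs S) (M : grRModType S) (u : tens M B -> M).
Hypothesis uM : is_twisted u.

Let hu : is_grhom 1 u := proj1 uM.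

Definition tens_diff (t : tens M B) : tens M B := codiff t + hat u t.

(** The boundary of a degree -1 endomorphism of (M, u): a null-homotopy of the identity is an h
    whose boundary is [gid]. *)
Definition hbound (h : tens M B -> M) (t : tens M B) : M :=
  gdelta (-1) h t + gcomp u h t + gcomp h u t.

Lemma tens_diff_hom : is_grhom 1 tens_diff.
Proof. exact: add_hom (@codiff_hom _ B M) (hat_hom hu). Qed.

(** As [codiff] squares to 0, the square of d = [codiff] + [hat u] is [hat] of the left-hand side of
    the twisting equation of u. *)
Lemma tens_diff2 t : tens_diff (tens_diff t) = 0.
Proof.
rewrite /tens_diff (grhomD (@codiff_hom _ B M)) (hatD hu) codiff2 add0r.
have huc := comp_hom hu (@codiff_hom _ B M); have huu := gcomp_hom hu hu.
have : hat (fun t => u (codiff t) + gcomp u u t) t = 0.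
  (* That [hat] of the zero map is zero is read off from additivity applied to 0 + 0. *)
  have z0 : is_grhom 0 (fun _ : tens M B => 0 : M).
    by split=> [x y|x s|i x _]; rewrite ?addr0 ?ract0l //; apply: hcomp0.
  rewrite (@eq_hat _ _ _ _ _ (fun=> 0)); last exact: (proj2 uM).
  have := hat_add z0 z0 t.
  rewrite (@eq_hat _ _ _ _ (fun=> 0 + 0) (fun=> 0)) => [|?]; last by rewrite addr0.
  by rewrite -[LHS]addr0 => /addrI.
by rewrite (hat_add huc huu) (hat_codiff hu) (hat_gcomp hu hu) opprK addrA
  [hat _ _ + _]addrC.
Qed.

Section Bound.
Variable h : tens M B -> M.
Hypothesis hh : is_grhom (-1) h.

Let hb1 : is_grhom 0 (gdelta (-1) h).
Proof. by have := comp_hom hh (@codiff_hom _ B M); rewrite subrr. Qed.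
Let hb2 : is_grhom 0 (gcomp u h).
Proof. by have := gcomp_hom hu hh; rewrite addNr. Qed.
Let hb3 : is_grhom 0 (gcomp h u).
Proof. by have := gcomp_hom hh hu; rewrite subrr. Qed.

Lemma hbound_hom : is_grhom 0 (hbound h).
Proof. exact: add_hom (add_hom hb1 hb2) hb3. Qed.

Lemma hat_hbound t : hat (hbound h) t = tens_diff (hat h t) + hat h (tens_diff t).
Proof.
rewrite (hat_add (add_hom hb1 hb2) hb3) (hat_add hb1 hb2).
rewrite (hat_gcomp hu hh) (hat_gcomp hh hu) /tens_diff (hatD hh).
rewrite [hat (gdelta _ _) t](hat_codiff hh) /zsign /= opprK.
by rewrite addrA [hat h _ + _]addrC -!addrA; congr (_ + _); rewrite addrCA.
Qed.

End Bound.

(* If E = [d, H1] is invertible then, as E commutes with d, H = E^-1 H1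
   satisfies [d, H] = id. *)
Lemma homotopically_trivial_of_invertible (h1 : tens M B -> M) :
  is_grhom (-1) h1 -> (forall t, hat (hbound h1) t = 0 -> t = 0) ->
  (forall t, exists s, hat (hbound h1) s = t) -> homotopically_trivial u.
Proof.
move=> hh1 Einj Esurj; have he := hbound_hom hh1.
have [G [hG EK GK]] := bij_hom (hat_hom he) Einj Esurj.
(* Both sides equal d H1 d, because d squares to 0. *)
have dE t : tens_diff (hat (hbound h1) t) = hat (hbound h1) (tens_diff t).
  rewrite !(hat_hbound hh1) (grhomD tens_diff_hom) !tens_diff2.
  by rewrite (grhom0 (hat_hom hh1)) add0r addr0.
have Gd t : G (tens_diff t) = tens_diff (G t) by rewrite -{1}[t]GK dE EK.
(* The inverse G of E is itself of the form [hat psi]: composing psi with the boundary of h1 gives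
   [gid], so [hat psi] is a left inverse of E. Hence G H1 is [hat] of the composite of psi and
   h1. *)
pose psi t := gid (G t).
have hpsi : is_grhom 0 psi by exact: comp_hom (gid_hom B M) hG.
have hat_psi t : hat psi t = G t.
  rewrite -{1}[t]GK -(hat_gcomp hpsi he) -[RHS]hat_gid.
  by apply: eq_hat => {}t; rewrite gcompE /psi EK.
have hh : is_grhom (-1) (gcomp psi h1).
  by have := gcomp_hom hpsi hh1; rewrite addr0.
exists (gcomp psi h1); split=> // t.
(* Through [gid_hat] the claim becomes d G H1 + G H1 d = id, and pulling G out leaves G E = id. *)
rewrite -[RHS]/(hbound (gcomp psi h1) t) -(gid_hat (hbound_hom hh)) (hat_hbound hh).
rewrite !(hat_gcomp hpsi hh1) !hat_psi -Gd -(grhomD hG) -(hat_hbound hh1).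
by rewrite EK.
Qed.

Variable T : triangular B.

Lemma gfirst_twisted2 m : gfirst T u (gfirst T u m) = 0.
Proof.
rewrite -(gfirst_gcomp T u hu) -[RHS](proj2 uM (m ⊗ bone T)) /gdelta.
by rewrite -/(codiff _) codiff_bone (grhom0 hu) zsign0 add0r.
Qed.

(** The [codiff] term vanishes on M ⊗ 1 because [delta] kills 1; what remains is the ordinary
    homotopy formula for first components. *)
Lemma gfirst_hbound (h : tens M B -> M) m : is_grhom (-1) h ->
  hbound h (m ⊗ bone T) =
    gfirst T u (gfirst T h m) + gfirst T h (gfirst T u m).
Proof.
move=> hh; rewrite -(gfirst_gcomp T u hh) -(gfirst_gcomp T h hu) /hbound /gdelta.
by rewrite -/(codiff _) codiff_bone (grhom0 hh) zsign0 add0r.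
Qed.

(** Evaluating the homotopy equation on M ⊗ 1 shows that the first component of h contracts (M,
    u^0). *)
Lemma homotopically_trivial_acyclic :
  homotopically_trivial u -> acyclic (gfirst T u).
Proof.
move=> [h [hh hE]] i; apply/seteqP; split=> [m [hm um]|_ [m hm <-]].
  exists (gfirst T h m); first exact: grhom_deg (gfirst_hom T hh) _ _ hm.
  rewrite -[RHS](gid_bone T) hE -/(hbound _ _) (gfirst_hbound _ hh) um.
  by rewrite (grhom0 (gfirst_hom T hh)) addr0.
split; last exact: gfirst_twisted2.
by rewrite -[i](subrK 1); apply: grhom_deg (gfirst_hom T hu) _ _ hm.
Qed.

Lemma contractible_homotopically_trivial (h0 : M -> M) : is_grhom (-1) h0 ->
  (forall m, gfirst T u (h0 m) + h0 (gfirst T u m) = m) ->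
  homotopically_trivial u.
Proof.
move=> hh0 h0E; pose h1 (t : tens M B) := h0 (gid t).
have hh1 : is_grhom (-1) h1.
  by have := comp_hom hh0 (gid_hom B M); rewrite add0r.
(* [phi] measures how far h1 is from being a null-homotopy. It vanishes on M ⊗ 1 because h0 is a
   contraction, so E = id + [hat phi] is unipotent. *)
pose phi t := hbound h1 t + - gid t.
have hphi : is_grhom 0 phi by exact: add_hom (hbound_hom hh1) (opp_hom (gid_hom B M)).
have phi0 m : phi (m ⊗ bone T) = 0.
  by rewrite /phi (gfirst_hbound _ hh1) /gfirst /h1 !gid_bone h0E subrr.
have EE t : hat (hbound h1) t = t + hat phi t.
  rewrite -{2}[t]hat_gid -(hat_add (gid_hom B M) hphi).
  by apply: eq_hat => {}t; rewrite /phi addrC subrK.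
apply: (homotopically_trivial_of_invertible hh1) => t.
  by rewrite EE; apply: hat_unipotent_inj hphi phi0 t.
have [s sE] := hat_unipotent_surj hphi phi0 t.
by exists s; rewrite EE.
Qed.

End Homotopy.

Theorem theorem8p3 (k : fieldType) (n : nat) (B : dgBocs {ffun 'I_n -> k})
    (kB : k_central B) (T : triangular B)
    (M : grRModType {ffun 'I_n -> k}) (u : tens M B -> M)
    (uM : is_twisted u) :
  homotopically_trivial u <-> acyclic (gfirst T u).
Proof.
split=> [|ac]; first exact: homotopically_trivial_acyclic.
have [h0 hh0 h0E] := acyclic_contractible (gfirst_hom T (proj1 uM))
  (gfirst_twisted2 uM T) ac.
exact: contractible_homotopically_trivial hh0 h0E.
Qed.
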